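(* Let $k>n$ be positive integers, and let $\Omega$ be a nonempty open subset of $\mathbb{R}^k$. Then there is no injective mapping in the class $C^{0,\frac12+}(\Omega;\mathbb{H}^n)$ that is also locally Lipschitz when considered as a map from $\Omega$ into the Euclidean space $\mathbb{R}^{2n+1}$.
   Context: The Heisenberg group $\mathbb{H}^n$ is $\mathbb{C}^n\times\mathbb{R}=\mathbb{R}^{2n+1}$, with points $(z,t)=(x_1,y_1,\ldots,x_n,y_n,t)$, $z_j=x_j+iy_j$, and group law $(z,t)*(z',t')=\left(z+z',\,t+t'+2\,\mathrm{Im}\sum_{j=1}^n z_j\overline{z_j'}\right)$. The left-invariant horizontal vector fields are $X_j=\frac{\partial}{\partial x_j}+2y_j\frac{\partial}{\partial t}$, $Y_j=\frac{\partial}{\partial y_j}-2x_j\frac{\partial}{\partial t}$ ($j=1,\ldots,n$). The horizontal space at $p$ is $H_p\mathbb{H}^n=\mathrm{span}\{X_1(p),\ldots,X_n(p),Y_1(p),\ldots,Y_n(p)\}$, equipped with the inner product making these $2n$ vectors orthonormal. An absolutely continuous curve $\gamma\colon[a,b]\to\mathbb{R}^{2n+1}$ is horizontal if $\gamma'(s)\in H_{\gamma(s)}\mathbb{H}^n$ for almost every $s$; its length is the integral of the norm of $\gamma'$ with respect to this inner product. The Carnot–Carathéodory metric $d_{cc}(p,q)$ is the infimum of lengths of horizontal curves joining $p$ to $q$. $\mathbb{H}^n$ is always regarded as the metric space $(\mathbb{H}^n,d_{cc})$. For $0<a<1$, a mapping $f\colon X\to Y$ between metric spaces is in the class $C^{0,a+}(X;Y)$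 if there is a non-decreasing continuous function $\beta\colon[0,\infty)\to[0,\infty)$ with $\beta(0)=0$ such that for all $x,y\in X$, $d_Y(f(x),f(y))\le d_X(x,y)^{a}\,\beta(d_X(x,y))$. The set $\Omega$ carries the Euclidean metric. *)

(* Defs.v *)
From HB Require Import structures.
From mathcomp Require Import all_boot all_order all_algebra.
From mathcomp Require Import all_classical all_reals all_analysis.

Set Implicit Arguments.
Unset Strict Implicit.
Unset Printing Implicit Defensive.

Import Order.TTheory GRing.Theory Num.Theory.
Import numFieldNormedType.Exports.

Local Open Scope classical_set_scope.
Local Open Scope ring_scope.

(* The library norm on 'rV[R]_m is the sup norm, hence the explicit
   Euclidean distance. *)
Definition eucl_norm (R : realType) (m : nat) (v : 'rV[R]_m) : R :=
  Num.sqrt (\sum_(i < m) v 0 i ^+ 2).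

Definition eucl_dist (R : realType) (m : nat) (p q : 'rV[R]_m) : R :=
  eucl_norm (p - q).

(* Points of the n-th Heisenberg group are vectors
   (x_1, y_1, ..., x_n, y_n, t) of R^(2n+1). *)
Notation heis R n := 'rV[R]_((n : nat).*2.+1).

Definition xidx (n : nat) (j : 'I_n) : 'I_n.*2.+1 := inord j.*2.
Definition yidx (n : nat) (j : 'I_n) : 'I_n.*2.+1 := inord j.*2.+1.
Definition tidx (n : nat) : 'I_n.*2.+1 := ord_max.

Definition hX (R : realType) (n : nat) (p : heis R n) (j : 'I_n) : heis R n :=
  delta_mx 0 (xidx j) + (2 * p 0 (yidx j)) *: delta_mx 0 (tidx n).

Definition hY (R : realType) (n : nat) (p : heis R n) (j : 'I_n) : heis R n :=
  delta_mx 0 (yidx j) - (2 * p 0 (xidx j)) *: delta_mx 0 (tidx n).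

Definition hframe (R : realType) (n : nat) (p : heis R n) :
    (n + n).-tuple (heis R n) :=
  [tuple of mktuple (hX p) ++ mktuple (hY p)].

Definition hspace (R : realType) (n : nat) (p : heis R n) : {vspace heis R n} :=
  <<hframe p>>%VS.

(* Norm of the inner product on [hspace p] for which [hframe p], a free family
   by [hframe_free] below, is orthonormal. *)
Definition hnorm (R : realType) (n : nat) (p v : heis R n) : R :=
  Num.sqrt (\sum_(i < n + n) coord (hframe p) i v ^+ 2).

Definition abs_continuous (R : realType) (m : nat) (a b : R)
    (gamma : R -> 'rV[R]_m) : Prop :=
  forall e : R, 0 < e -> exists2 d : R, 0 < d &
    forall (N : nat) (u v : 'I_N -> R),
      (forall i, [/\ a <= u i, u i < v i & v i <= b]) ->
      trivIset setT (fun i => `]u i, v i[%classic) ->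
      \sum_(i < N) (v i - u i) < d ->
      \sum_(i < N) eucl_dist (gamma (u i)) (gamma (v i)) < e.

(* A curve on [a, b] is a total function considered only on [a, b]. The
   derivative at the end points depends on values outside [a, b], which is
   harmless in statements and integrals up to null sets. *)
Definition horizontal (R : realType) (n : nat) (a b : R)
    (gamma : R -> heis R n) : Prop :=
  abs_continuous a b gamma /\
  {ae (@lebesgue_measure R), forall s, s \in `[a, b] ->
    derivable gamma s 1 /\ derive1 gamma s \in hspace (gamma s)}.

Definition hlength (R : realType) (n : nat) (a b : R)
    (gamma : R -> heis R n) : \bar R :=
  (\int[lebesgue_measure]_(s in `[a, b])
     (hnorm (gamma s) (derive1 gamma s))%:E)%E.

Definition dcc (R : realType) (n : nat) (p q : heis R n) : \bar R :=
  ereal_inf [set l | exists (a b : R) (gamma : R -> heis R n),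
    [/\ a < b, horizontal a b gamma, gamma a = p, gamma b = q
      & l = hlength a b gamma]].

(* The class C^{0,a+}, for maps from the subset A of X to Y. The target
   distance is extended-real-valued because [dcc] is an infimum in \bar R. *)
Definition holder_plus (R : realType) (X Y : Type) (dX : X -> X -> R)
    (dY : Y -> Y -> \bar R) (a : R) (A : set X) (f : X -> Y) : Prop :=
  exists beta : R -> R,
    [/\ {within `[0, +oo[, continuous beta},
        {in `[0, +oo[ &, {homo beta : s t / s <= t}},
        forall s, 0 <= s -> 0 <= beta s,
        beta 0 = 0
      & forall x y, A x -> A y ->
          (dY (f x) (f y) <= (dX x y `^ a * beta (dX x y))%:E)%E].

Definition locally_lipschitz (R : realType) (k m : nat) (A : set 'rV[R]_k)
    (f : 'rV[R]_k -> 'rV[R]_m) : Prop :=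
  forall x, A x -> exists2 U : set 'rV[R]_k, nbhs x U &
    exists L : R, forall y z, (A `&` U) y -> (A `&` U) z ->
      eucl_dist (f y) (f z) <= L * eucl_dist y z.

Lemma val_xidx (n : nat) (j : 'I_n) : xidx j = j.*2 :> nat.
Proof. by rewrite inordK// ltnS leq_double ltnW. Qed.

Lemma val_yidx (n : nat) (j : 'I_n) : yidx j = j.*2.+1 :> nat.
Proof. by rewrite inordK// ltnS ltn_double. Qed.

Lemma xidx_inj (n : nat) : injective (@xidx n).
Proof.
move=> i j /(congr1 val) /=; rewrite val_xidx val_xidx => ij.
by apply/val_inj/double_inj.
Qed.

Lemma yidx_inj (n : nat) : injective (@yidx n).
Proof.
move=> i j /(congr1 val) /=; rewrite val_yidx val_yidx => -[ij].
by apply/val_inj/double_inj.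
Qed.

Lemma xidx_neq_yidx (n : nat) (i j : 'I_n) : (xidx i == yidx j) = false.
Proof.
apply/eqP => /(congr1 (odd \o val)) /=.
by rewrite val_xidx val_yidx /= !odd_double.
Qed.

Lemma xidx_neq_tidx (n : nat) (i : 'I_n) : (xidx i == tidx n) = false.
Proof.
apply/eqP => /(congr1 val) /=; rewrite val_xidx => /eqP.
by rewrite ltn_eqF// ltn_double.
Qed.

Lemma yidx_neq_tidx (n : nat) (i : 'I_n) : (yidx i == tidx n) = false.
Proof.
apply/eqP => /(congr1 (odd \o val)) /=.
by rewrite val_yidx /= !odd_double.
Qed.

Lemma hframe_lshift (R : realType) (n : nat) (p : heis R n) (j : 'I_n) :
  (hframe p)`_(lshift n j) = hX p j.
Proof.
by rewrite nth_cat size_tuple [(_ < n)%N](ltn_ord j); exact: nth_mktuple.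
Qed.

Lemma hframe_rshift (R : realType) (n : nat) (p : heis R n) (j : 'I_n) :
  (hframe p)`_(rshift n j) = hY p j.
Proof.
by rewrite nth_cat size_tuple /= ltnNge leq_addr/= addKn; exact: nth_mktuple.
Qed.

Lemma hcomb_xidx (R : realType) (n : nat) (p : heis R n) (c : 'I_(n + n) -> R)
    (j : 'I_n) :
  (\sum_i c i *: (hframe p)`_i) 0 (xidx j) = c (lshift n j).
Proof.
rewrite summxE big_split_ord /= [X in _ + X]big1 ?addr0 => [|i _]; last first.
  rewrite hframe_rshift !mxE eqxx xidx_neq_yidx xidx_neq_tidx/=.
  by rewrite mulr0 subr0 mulr0.
rewrite (bigD1 j)//= big1 ?addr0 => [|i ij].
  by rewrite hframe_lshift !mxE !eqxx xidx_neq_tidx/= mulr0 addr0 mulr1.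
rewrite hframe_lshift !mxE eqxx xidx_neq_tidx/= (inj_eq (@xidx_inj _)).
by rewrite eq_sym (negbTE ij) mulr0 addr0 mulr0.
Qed.

Lemma hcomb_yidx (R : realType) (n : nat) (p : heis R n) (c : 'I_(n + n) -> R)
    (j : 'I_n) :
  (\sum_i c i *: (hframe p)`_i) 0 (yidx j) = c (rshift n j).
Proof.
rewrite summxE big_split_ord /= [X in X + _]big1 ?add0r => [|i _]; last first.
  rewrite hframe_lshift !mxE eqxx [_ == xidx _]eq_sym xidx_neq_yidx.
  rewrite yidx_neq_tidx/=.
  by rewrite mulr0 addr0 mulr0.
rewrite (bigD1 j)//= big1 ?addr0 => [|i ij].
  by rewrite hframe_rshift !mxE !eqxx yidx_neq_tidx/= mulr0 subr0 mulr1.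
rewrite hframe_rshift !mxE eqxx yidx_neq_tidx/= (inj_eq (@yidx_inj _)).
by rewrite eq_sym (negbTE ij) mulr0 subr0 mulr0.
Qed.

Lemma hframe_free (R : realType) (n : nat) (p : heis R n) : free (hframe p).
Proof.
apply/freeP => c c0 i; case: (split_ordP i) => j ->.
  by rewrite -(hcomb_xidx p c) c0 mxE.
by rewrite -(hcomb_yidx p c) c0 mxE.
Qed.

Lemma hnormE (R : realType) (n : nat) (p v : heis R n) : v \in hspace p ->
  hnorm p v = Num.sqrt (\sum_(j < n) (v 0 (xidx j) ^+ 2 + v 0 (yidx j) ^+ 2)).
Proof.
move=> vp; rewrite /hnorm big_split_ord /= big_split /=.
congr (Num.sqrt (_ + _)); apply: eq_bigr => j _.
- by rewrite [in RHS](coord_span vp) hcomb_xidx.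
- by rewrite [in RHS](coord_span vp) hcomb_yidx.
Qed.

(* Main.v *)
(* Suppose f exists, and let F be its restriction to a small (n+1)-cube,
   extended to R^(n+1) by clamping the coordinates. Along a horizontal curve of
   length l the contact form of the chord is O(l^2), so the class C^{0,1/2+}
   makes the contact form o(h) on the F-image of an edge of length h. On the
   grid of mesh 1/N this exhibits the pullback of the symplectic form
   sum_j dx_j dy_j as the coboundary of an o(1) cochain; by summation by parts
   it tends to 0 weakly, even after a cup product with pullbacks of other
   coordinate differentials. Every (n+1)-form in the dx_j, dy_j is a multiple of
   the symplectic form (Lefschetz), and dt is a combination of the dx_j, dy_j up
   to o(1), so all (n+1)-forms pull back to weak null sequences.
   On the other hand, f being injective, the F-images of opposite slabs of the
   cube are disjoint compact sets, which are separated by functions G_i of class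
   C^{1,1}; by Stokes the integral of d(G_0 o F) ... d(G_n o F) is 1, whereas the
   chain rule makes it tend to 0. Working with cochains on grids avoids the
   almost everywhere differentiability of f. *)

Require Import Defs.
From HB Require Import structures.
From mathcomp Require Import all_boot all_order all_algebra.
From mathcomp Require Import all_classical all_reals all_analysis.
From mathcomp Require Import measurable_realfun ring lra zify.

Set Implicit Arguments.
Unset Strict Implicit.
Unset Printing Implicit Defensive.

Import Order.TTheory GRing.Theory Num.Theory.
Import numFieldNormedType.Exports.

Local Open Scope ring_scope.

(** * Cubical cochains *)

(** The obstacle is that weak limits do not pass through products. What saves them is exactness:
    every factor is the coboundary of a Lipschitz function, so an error that is the coboundary of a
    small cochain keeps this form after multiplication by the other factors, and one summation by
    parts moves the coboundary to the test function. All estimates are therefore stated for every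
    Lipschitz test function [psi] vanishing off the open cube, and the coefficients of the chain
    rule are absorbed in [psi]. They must be Lipschitz for that, whence the class C^{1,1} of the
    separating functions. The exponent 1/2 enters through the length: l <= h^(1/2) beta(h) turns
    O(l^2) into O(h beta(h)^2) = o(h). The dimension enters by counting: more than n distinct
    letters dx_j, dy_j contain more complete pairs than there are missing indices. Anticommutation
    and the Lefschetz relation hold only up to null sequences, hence words modulo a subgroup [P] in
    place of an exterior algebra. The degree, by contrast, is exactly 1 on every fine grid. *)

(* [w A x] is the coefficient of dx_A at the vertex [x], [sh i] is the step in
   direction [i] and [c] the inverse of the mesh. [cob] is the coboundary,
   [ecup e] the cup product with the edge cochain [e], and [dcup g] the one with
   the coboundary of the function [g]. *)
Section Cochain.
Variables (R : realFieldType) (k : nat) (X : Type) (sh : 'I_k -> X -> X) (c : R).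
Hypothesis shC : forall i j x, sh i (sh j x) = sh j (sh i x).

Definition cochain := {set 'I_k} -> X -> R.

Definition possgn (i : 'I_k) (A : {set 'I_k}) : R :=
  (-1) ^+ #|[set j in A | (j < i)%N]|.

Definition cob (w : cochain) : cochain := fun A x =>
  c * \sum_(i in A) possgn i A * (w (A :\ i) (sh i x) - w (A :\ i) x).

Definition scalec (g : X -> R) (w : cochain) : cochain := fun A x => g x * w A x.

(** [e] is read on the edge leaving [x] and [w] on the opposite face, based at [sh i x]; this makes
    the Leibniz rule [cob_scalec] exact on the grid. *)
Definition ecup (e : 'I_k -> X -> R) (w : cochain) : cochain := fun A x =>
  \sum_(i in A) possgn i A * (e i x * w (A :\ i) (sh i x)).

Definition dif (g : X -> R) (i : 'I_k) (x : X) : R := c * (g (sh i x) - g x).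

Definition dcup (g : X -> R) : cochain -> cochain := ecup (dif g).

Definition addc (v w : cochain) : cochain := fun A x => v A x + w A x.
Definition oppc (w : cochain) : cochain := fun A x => - w A x.
Definition zeroc : cochain := fun _ _ => 0.
Definition onec : cochain := fun A x => (A == finset.set0)%:R.

Lemma cochainP (v w : cochain) : (forall A x, v A x = w A x) -> v = w.
Proof. by move=> vw; apply/funext => A; apply/funext => x; exact: vw. Qed.

Lemma cobD v w : cob (addc v w) = addc (cob v) (cob w).
Proof.
apply: cochainP => A x; rewrite /cob /addc -mulrDr -big_split /=.
by congr (_ * _); apply: eq_bigr => i _; ring.
Qed.

Lemma ecupD e v w : ecup e (addc v w) = addc (ecup e v) (ecup e w).
Proof.
apply: cochainP => A x; rewrite /ecup /addc -big_split /=.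
by apply: eq_bigr => i _; ring.
Qed.

Lemma ecupN e w : ecup e (oppc w) = oppc (ecup e w).
Proof.
apply: cochainP => A x; rewrite /ecup /oppc -sumrN.
by apply: eq_bigr => i _; ring.
Qed.

Lemma cob_oppc w : cob (oppc w) = oppc (cob w).
Proof.
apply: cochainP => A x; rewrite /cob /oppc -mulrN -sumrN.
by congr (_ * _); apply: eq_bigr => i _; ring.
Qed.

Lemma ecup0 e : ecup e zeroc = zeroc.
Proof.
by apply: cochainP => A x; rewrite /ecup /zeroc big1// => i _; rewrite !mulr0.
Qed.

Lemma cob1 : cob onec = zeroc.
Proof.
apply: cochainP => A x; rewrite /cob /zeroc /onec big1 ?mulr0// => i _.
by rewrite subrr mulr0.
Qed.

Lemma cob_scalec g w : cob (scalec g w) = addc (dcup g w) (scalec g (cob w)).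
Proof.
apply: cochainP => A x; rewrite /cob /addc /dcup /ecup /scalec /dif.
rewrite mulrCA !mulr_sumr -big_split /=.
by apply: eq_bigr => i _; ring.
Qed.

(** Deleting one of two indices changes the sign of the other exactly when the deleted one is
    smaller, so just one of the two products flips. *)
Lemma possgn_swap (i j : 'I_k) (A : {set 'I_k}) : i \in A -> j \in A -> i != j ->
  possgn i A * possgn j (A :\ i) = - (possgn j A * possgn i (A :\ j)).
Proof.
have card_del (a b : 'I_k) (B : {set 'I_k}) : a \in B ->
    #|[set l in B | (l < b)%N]| =
    ((a < b)%N + #|[set l in B :\ a | (l < b)%N]|)%N.
  move=> aB; rewrite (cardsD1 a) inE aB /=; congr (_ + #|pred_of_set _|)%N.
  by apply/setP => l; rewrite !inE andbA.
move=> iA jA ij; rewrite /possgn (card_del j i A)// (card_del i j A)//.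
have [lt_ij|lt_ji|/val_inj eq_ij] := ltngtP i j.
- rewrite add0n add1n exprS; ring.
- rewrite add0n add1n exprS; ring.
- by rewrite eq_ij eqxx in ij.
Qed.

Lemma sum_antisym (F : 'I_k -> 'I_k -> R) (A : {set 'I_k}) :
  (forall i j, i \in A -> j \in A -> i != j -> F i j = - F j i) ->
  \sum_(i in A) \sum_(j in A :\ i) F i j = 0.
Proof.
move=> FN; set S := LHS.
have SE : S = \sum_(i in A) \sum_(j in A | j != i) F i j.
  apply: eq_bigr => i _; apply: eq_bigl => j.
  by rewrite !inE andbC.
suff : S = - S by move=> SN; lra.
rewrite SE -[in RHS]sumrN.
rewrite (exchange_big_dep (mem A))//=; last by move=> i j _ /andP[].
apply: eq_bigr => j jA; rewrite -sumrN.
apply: eq_big => [i|i]; first by rewrite jA eq_sym.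
by move=> /andP[iA /andP[_ ij]]; apply: FN => //; rewrite eq_sym.
Qed.

Lemma cob_cob w : cob (cob w) = zeroc.
Proof.
apply: cochainP => A x; rewrite /zeroc /cob.
pose F i j : R := possgn i A * possgn j (A :\ i) *
  (w (A :\ i :\ j) (sh i (sh j x)) - w (A :\ i :\ j) (sh i x)
   - w (A :\ i :\ j) (sh j x) + w (A :\ i :\ j) x).
transitivity (c * (c * \sum_(i in A) \sum_(j in A :\ i) F i j)).
  congr (_ * _); rewrite mulr_sumr; apply: eq_bigr => i _.
  rewrite -mulrBr mulrCA -sumrB; congr (_ * _).
  by rewrite mulr_sumr; apply: eq_bigr => j _; rewrite /F -(shC i j); ring.
rewrite sum_antisym ?mulr0// /F.
move=> i j iA jA ij; rewrite possgn_swap// (shC j i).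
by rewrite !finset.setDDl (finset.setUC [set j]); ring.
Qed.

(** Obtained by applying [cob] to the Leibniz rule: both double coboundaries vanish, and no sign has
    to be handled. *)
Lemma cob_dcup g w : cob (dcup g w) = oppc (dcup g (cob w)).
Proof.
have /(congr1 cob) := cob_scalec g w.
rewrite cob_cob cobD cob_scalec cob_cob => E.
apply: cochainP => A x.
have := congr1 (fun f : cochain => f A x) E.
rewrite /addc /zeroc /oppc /scalec mulr0 addr0 => /eqP.
by rewrite eq_sym addr_eq0 => /eqP.
Qed.

Definition wedge (gs : seq (X -> R)) (w : cochain) : cochain := foldr dcup w gs.

Lemma wedgeD gs v w : wedge gs (addc v w) = addc (wedge gs v) (wedge gs w).
Proof. by elim: gs => //= g gs ->; rewrite /dcup ecupD. Qed.

Lemma wedge_oppc gs w : wedge gs (oppc w) = oppc (wedge gs w).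
Proof. by elim: gs => //= g gs ->; rewrite /dcup ecupN. Qed.

Lemma wedge0 gs : wedge gs zeroc = zeroc.
Proof. by elim: gs => //= g gs ->; rewrite /dcup ecup0. Qed.

Lemma wedge_cat gs hs w : wedge (gs ++ hs) w = wedge gs (wedge hs w).
Proof. by rewrite /wedge foldr_cat. Qed.

Lemma oppcK w : oppc (oppc w) = w.
Proof. by apply: cochainP => A x; rewrite /oppc opprK. Qed.

Lemma oppc0 : oppc zeroc = zeroc.
Proof. by apply: cochainP => A x; rewrite /oppc oppr0. Qed.

Lemma cob_wedge gs w : cob (wedge gs w) =
  if odd (size gs) then oppc (wedge gs (cob w)) else wedge gs (cob w).
Proof.
elim: gs => //= g gs IH; rewrite cob_dcup IH.
by case: odd => //=; rewrite /dcup ecupN oppcK.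
Qed.

Lemma cob_wedge1 gs : cob (wedge gs onec) = zeroc.
Proof. by rewrite cob_wedge cob1 wedge0 oppc0 if_same. Qed.

(** The sign stays hidden in [b]: it is used once under an absolute value and once for an integral
    that turns out to be 0. *)
Lemma wedge_cob gs w : exists b : bool,
  wedge gs (cob w) = cob (if b then oppc (wedge gs w) else wedge gs w).
Proof.
exists (odd (size gs)); have := cob_wedge gs w.
by case: odd => E; rewrite ?cob_oppc E// oppcK.
Qed.

(* The primitive of the antisymmetry defect is quadratic in the differences of
   [u] and [v], hence small on fine grids. *)
Lemma dcup_anticomm u v w : cob w = zeroc ->
  addc (dcup u (dcup v w)) (dcup v (dcup u w)) =
  cob (oppc (ecup (fun i x => c * (u (sh i x) - u x) * (v (sh i x) - v x)) w)).
Proof.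
move=> w0.
have E : ecup (fun i x => c * (u (sh i x) - u x) * (v (sh i x) - v x)) w =
   addc (dcup (fun x => u x * v x) w)
    (oppc (addc (scalec u (dcup v w)) (scalec v (dcup u w)))).
  apply: cochainP => A x.
  rewrite /addc /oppc /scalec /dcup /ecup /dif !mulr_sumr -big_split/= -sumrB.
  by apply: eq_bigr => i _; ring.
rewrite E cob_oppc cobD cob_dcup w0 /dcup ecup0 -/(dcup _) oppc0 cob_oppc cobD.
rewrite !cob_scalec !cob_dcup w0 /dcup !ecup0.
by apply: cochainP => A x; rewrite /addc /oppc /scalec /zeroc; ring.
Qed.

(** For closed [w] the coboundary of u dv w is du dv w, and dp w is closed for any [p]. The freedom
    in [p] allows the primitive to be the contact form, which is small, whereas sum_j u_j dv_j alone
    is not. *)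
Lemma dcup_contact (I : finType) (u v : I -> X -> R) (p : X -> R) w :
  cob w = zeroc ->
  (fun A x => \sum_j dcup (u j) (dcup (v j) w) A x) =
  cob (ecup (fun i x => \sum_j u j x * dif (v j) i x + dif p i x) w).
Proof.
move=> w0.
have -> : ecup (fun i x => \sum_j u j x * dif (v j) i x + dif p i x) w =
   addc (fun A x => \sum_j scalec (u j) (dcup (v j) w) A x) (dcup p w).
  apply: cochainP => A x.
  rewrite /addc /scalec /dcup /ecup.
  under eq_bigr do rewrite mulrDl mulrDr mulr_suml mulr_sumr.
  rewrite big_split/= exchange_big /=; congr (_ + _).
  apply: eq_bigr => j _; rewrite mulr_sumr.
  by apply: eq_bigr => i _; ring.
rewrite cobD cob_dcup w0 /dcup ecup0 -/(dcup _) oppc0.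
apply: cochainP => A x; rewrite /addc /zeroc addr0.
transitivity (\sum_j cob (scalec (u j) (dcup (v j) w)) A x).
  apply: eq_bigr => j _; rewrite cob_scalec cob_dcup w0 /addc /oppc /scalec.
  by rewrite /dcup ecup0 /zeroc oppr0 mulr0 addr0.
rewrite /cob -mulr_sumr exchange_big /=; congr (_ * _).
by apply: eq_bigr => i _; rewrite -sumrB -mulr_sumr.
Qed.

Definition boundc (M : R) (w : cochain) := forall A x, `|w A x| <= M.

Lemma ecup_bound M e w b : 0 <= b -> (forall i x, `|e i x| <= b) ->
  boundc M w -> boundc (k%:R * b * M) (ecup e w).
Proof.
move=> b0 eb wM A x.
have M0 : 0 <= M by apply: le_trans (wM finset.set0 x).
apply: le_trans (ler_norm_sum _ _ _) _.
apply: (@le_trans _ _ (\sum_(i in A) b * M)).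
  apply: ler_sum => i _; rewrite !normrM /possgn normr_sign mul1r.
  by rewrite ler_pM// ?wM.
rewrite sumr_const -(mulr_natl (b * M)) -(mulrA k%:R) ler_wpM2r ?mulr_ge0// ler_nat.
by rewrite -[leqRHS](card_ord k) max_card.
Qed.

End Cochain.

(** * Weak convergence on fine grids *)

Section NullSeq.
Variable R : realType.
Implicit Types s t : nat -> R.

Definition nullseq s := forall e, 0 < e ->
  exists N0, forall N, (N0 <= N)%N -> `|s N| <= e.

Lemma nullseq0 : nullseq (fun=> 0).
Proof. by move=> e e0; exists 0%N => N _; rewrite normr0 ltW. Qed.

Lemma nullseqM M s t : (forall N, `|t N| <= M * `|s N|) ->
  nullseq s -> nullseq t.
Proof.
move=> ts s0 e e0.
have M0 : 0 < `|M| + 1 by rewrite ltr_wpDl.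
have [N0 sN] := s0 (e / (`|M| + 1)) (divr_gt0 e0 M0).
exists N0 => N /sN sNe; apply: le_trans (ts N) _.
apply: (@le_trans _ _ ((`|M| + 1) * `|s N|)).
  by rewrite ler_wpM2r// (le_trans (ler_norm _))// lerDl.
by rewrite -ler_pdivlMl// mulrC.
Qed.

Lemma nullseqD s t : nullseq s -> nullseq t -> nullseq (fun N => s N + t N).
Proof.
move=> s0 t0 e e0; have e2 : 0 < e / 2 by rewrite divr_gt0.
have [N1 sN] := s0 _ e2; have [N2 tN] := t0 _ e2.
exists (maxn N1 N2) => N; rewrite geq_max => /andP[/sN sNe /tN tNe].
by rewrite (le_trans (ler_normD _ _))// [leRHS](splitr e) lerD.
Qed.

Lemma nullseqZ a s : nullseq s -> nullseq (fun N => a * s N).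
Proof. by apply: (@nullseqM `|a|) => N; rewrite normrM. Qed.

Lemma nullseqN s : nullseq s -> nullseq (fun N => - s N).
Proof. by apply: (@nullseqM 1) => N; rewrite normrN mul1r. Qed.

Lemma nullseq_sum (I : Type) (r : seq I) (P : pred I) (s : I -> nat -> R) :
  (forall i, P i -> nullseq (s i)) -> nullseq (fun N => \sum_(i <- r | P i) s i N).
Proof.
move=> s0; elim: r => [|i r IH].
  apply: (@nullseqM 1 (fun=> 0)); last exact: nullseq0.
  by move=> N; rewrite big_nil normr0 mulr0.
case: (boolP (P i)) => Pi; last first.
  apply: nullseqM IH => N; rewrite big_cons (negbTE Pi).
  by rewrite -[leLHS]mul1r.
apply: (@nullseqM 1) (nullseqD (s0 _ Pi) IH) => N.
by rewrite big_cons Pi mul1r.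
Qed.

Lemma nullseq_ext s t : (forall N, s N = t N) -> nullseq s -> nullseq t.
Proof. by move=> st; apply: (@nullseqM 1) => N; rewrite st mul1r. Qed.

Lemma nullseq_inv : nullseq (fun N => N.+1%:R^-1).
Proof.
move=> e e0; exists (Num.bound e^-1) => N bN.
rewrite gtr0_norm ?invr_gt0 ?ltr0n// -[leRHS]invrK lef_pV2 ?posrE ?invr_gt0//.
  have e1 : 0 <= e^-1 by rewrite invr_ge0 ltW.
  by rewrite (le_trans (ltW (archi_boundP e1)))// ler_nat ltnW.
Qed.

End NullSeq.

Section Grid.
Variables (R : realType) (k : nat).
Local Notation X := 'rV[R]_k.
Implicit Types (f g u v p psi : X -> R) (gs : seq (X -> R)).

Definition shv (h : R) (i : 'I_k) (x : X) : X := x + h *: delta_mx 0 i.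

Lemma shvC h i j x : shv h i (shv h j x) = shv h j (shv h i x).
Proof. by rewrite /shv addrAC. Qed.

Lemma shvE h i x j : shv h i x 0 j = x 0 j + h * (j == i)%:R.
Proof. by rewrite /shv !mxE eqxx. Qed.

(** Only increments along the axes are controlled, since cochains see only the edges of a grid; size
    and slope share one constant. *)
Definition lipb f := exists2 L : R, forall x, `|f x| <= L &
  forall h i x, 0 <= h -> `|f (shv h i x) - f x| <= L * h.

Fixpoint lipb_seq gs := if gs is g :: gs' then lipb g /\ lipb_seq gs' else True.

Lemma lipb_ge0 f L : (forall x, `|f x| <= L) -> 0 <= L.
Proof. by move=> /(_ 0); apply: le_trans. Qed.

Lemma lipb_cst a : lipb (fun=> a).
Proof.
by exists `|a| => // h i x h0; rewrite subrr normr0 mulr_ge0.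
Qed.

Lemma lipbD f g : lipb f -> lipb g -> lipb (fun x => f x + g x).
Proof.
move=> [L fL dfL] [M gM dgM]; exists (L + M) => [x|h i x h0].
  by rewrite (le_trans (ler_normD _ _))// lerD.
rewrite opprD addrACA mulrDl (le_trans (ler_normD _ _))// lerD//.
  exact: dfL.
exact: dgM.
Qed.

Lemma lipbM f g : lipb f -> lipb g -> lipb (fun x => f x * g x).
Proof.
move=> [L fL dfL] [M gM dgM].
have L0 := lipb_ge0 fL; have M0 := lipb_ge0 gM.
exists (L * M + L * M) => [x|h i x h0].
  by rewrite normrM -[leLHS]addr0 lerD ?mulr_ge0// ler_pM.
have -> : f (shv h i x) * g (shv h i x) - f x * g x =
  f (shv h i x) * (g (shv h i x) - g x) + (f (shv h i x) - f x) * g x by ring.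
rewrite (le_trans (ler_normD _ _))// !normrM mulrDl.
have := dfL h i x h0; have := dgM h i x h0 => dg df.
apply: lerD; first by rewrite -mulrA ler_pM.
by rewrite mulrAC ler_pM.
Qed.

Lemma lipbZ a f : lipb f -> lipb (fun x => a * f x).
Proof. exact: lipbM (lipb_cst a). Qed.

Definition edgeo (r : R -> 'I_k -> X -> R) := forall e, 0 < e ->
  exists2 h0, 0 < h0 & forall h i x, 0 < h -> h < h0 -> `|r h i x| <= e * h.

Definition pt N (z : {ffun 'I_k -> 'I_N.+1}) : X :=
  \row_i ((z i : nat)%:R / N.+1%:R).

Definition gint N (w : X -> R) : R :=
  (N.+1%:R ^+ k)^-1 * \sum_z w (@pt N z).

(** The whole complement of the open cube is meant, so that a grid shift leaving the cube also meets
    a zero of a [cpt] function. *)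
Definition bdry (x : X) := exists i, (x 0 i <= 0) || (1 <= x 0 i).

Definition cpt psi := forall x, bdry x -> psi x = 0.

Lemma gint_bound N w M : (forall x, `|w x| <= M) -> `|gint N w| <= M.
Proof.
move=> wM; rewrite /gint normrM ger0_norm ?invr_ge0 ?exprn_ge0//.
rewrite ler_pdivrMl ?exprn_gt0 ?ltr0n//.
apply: le_trans (ler_norm_sum _ _ _) _.
apply: (@le_trans _ _ (\sum_(z : {ffun 'I_k -> 'I_N.+1}) M)).
  by apply: ler_sum => z _; exact: wM.
by rewrite sumr_const card_ffun !card_ord -(mulr_natl M) natrX.
Qed.

Lemma gintD N v w : gint N (fun x => v x + w x) = gint N v + gint N w.
Proof. by rewrite /gint big_split mulrDr. Qed.

Lemma gintN N w : gint N (fun x => - w x) = - gint N w.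
Proof. by rewrite /gint sumrN mulrN. Qed.

Lemma gint_sum N (I : finType) (w : I -> X -> R) :
  gint N (fun x => \sum_j w j x) = \sum_j gint N (w j).
Proof. by rewrite /gint exchange_big /= mulr_sumr. Qed.

Lemma eq_gint N v w : (forall x, v x = w x) -> gint N v = gint N w.
Proof. by move=> vw; congr (_ * _); apply: eq_bigr. Qed.

(** The shift is compared with the cyclic shift of indices. They differ only in the last layer,
    where one reaches coordinate 1 and the other coordinate 0, both zeros of [w]. *)
Lemma gint_shv N i w : cpt w ->
  gint N (fun x => w (shv N.+1%:R^-1 i x)) = gint N w.
Proof.
move=> w0; congr (_ * _).
pose s (z : {ffun 'I_k -> 'I_N.+1}) : {ffun 'I_k -> 'I_N.+1} :=
  [ffun j => if j == i then ordS (z j) else z j].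
have s_inj : injective s.
  move=> y z /ffunP yz; apply/ffunP => j; have := yz j; rewrite !ffunE.
  by case: eqP => // _ /(can_inj (@ordSK _)).
rewrite [RHS](reindex_inj s_inj) /=; apply: eq_bigr => z _.
have [ziN|] := ltnP (z i) N.
  congr w; apply/rowP => j; rewrite shvE !mxE ffunE.
  case: eqP => [->|_]; last by rewrite mulr0 addr0.
  by rewrite /= modn_small// mulr1 -(natr1 (z i)) mulrDl mul1r.
rewrite leq_eqVlt ltnNge -ltnS ltn_ord orbF => /eqP ziN.
rewrite !w0//; exists i; apply/orP; [left|right].
  by rewrite mxE ffunE eqxx /= -ziN modnn mul0r.
rewrite shvE eqxx mulr1 mxE -ziN -[X in _ + X]mul1r -mulrDl natr1.
by rewrite divff ?pnatr_eq0.
Qed.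

Local Notation hN N := (N.+1%:R^-1 : R).
Local Notation cobN N := (cob (shv (hN N)) N.+1%:R).
Local Notation dcupN N := (dcup (shv (hN N)) N.+1%:R).
Local Notation wedgeN N := (wedge (shv (hN N)) N.+1%:R).
Local Notation onek := (@onec R k X).
Local Notation setTk := [set: 'I_k]%SET.

Lemma gint_cob N w : (forall A, cpt (w A)) -> gint N (cobN N w setTk) = 0.
Proof.
move=> w0; rewrite /cob /gint -mulr_sumr exchange_big /=.
rewrite big1 ?mulr0// => i _; rewrite -mulr_sumr sumrB.
have /(congr1 (fun t => N.+1%:R ^+ k * t)) := @gint_shv N i _ (w0 (setTk :\ i)).
rewrite /gint !mulrA divff ?expf_neq0 ?pnatr_eq0// !mul1r => ->.
by rewrite subrr mulr0.
Qed.

Lemma gint_by_parts N psi w : cpt psi ->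
  gint N (fun x => psi x * cobN N w setTk x) =
  - gint N (dcupN N psi w setTk).
Proof.
move=> psi0.
have /eqP := @gint_cob N (scalec psi w)
   (fun A x xb => ltac:(by rewrite /scalec psi0// mul0r)).
rewrite cob_scalec /addc /scalec.
by rewrite gintD addrC addr_eq0 => /eqP.
Qed.

Lemma dif_bound N f L i x : (forall h i x, 0 <= h -> `|f (shv h i x) - f x| <= L * h) ->
  `|dif (shv (hN N)) N.+1%:R f i x| <= L.
Proof.
move=> fL; rewrite /dif normrM gtr0_norm ?ltr0n//.
rewrite -ler_pdivlMl ?ltr0n// mulrC.
by apply: fL; rewrite invr_ge0.
Qed.

(** [M] is independent of [N]: the mesh in the increment of a Lipschitz function cancels the factor
    [N.+1]. *)
Lemma dcup_bound f : lipb f -> exists2 M, 0 <= M &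
  forall N b w, boundc b w -> boundc (M * b) (dcupN N f w).
Proof.
move=> [L fL dfL]; have L0 := lipb_ge0 fL.
exists (k%:R * L) => [|N b w wb]; first by rewrite mulr_ge0.
by apply: ecup_bound => // i x; exact: dif_bound.
Qed.

Lemma wedge_bound gs : lipb_seq gs -> exists2 M, 0 <= M &
  forall N b w, boundc b w -> boundc (M * b) (wedgeN N gs w).
Proof.
elim: gs => [_|g gs IH [gl gsl]].
  by exists 1 => // N b w wb; rewrite mul1r.
have [M M0 gsM] := IH gsl; have [M' M'0 gM] := dcup_bound gl.
exists (M' * M) => [|N b w wb]; first by rewrite mulr_ge0.
by rewrite -mulrA; apply: gM; apply: gsM.
Qed.

Lemma onec_bound : boundc 1 onek.
Proof. by move=> A x; rewrite /onec; case: (_ == _); rewrite ?normr1 ?normr0. Qed.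

(* The Riemann sum of [psi] times the cup product of the differentials of [gs]. *)
Definition wint psi gs N := gint N (fun x => psi x * wedgeN N gs onek setTk x).

Definition unull (e : nat -> 'I_k -> X -> R) := forall a, 0 < a ->
  exists N0, forall N i x, (N0 <= N)%N -> `|e N i x| <= a.

Lemma wedge_ecup_null psi gs w (e : nat -> 'I_k -> X -> R) b :
  lipb psi -> lipb_seq gs -> (forall N, boundc b (w N)) -> unull e ->
  nullseq (fun N => gint N (fun x => psi x *
    wedgeN N gs (ecup (shv (hN N)) (e N) (w N)) setTk x)).
Proof.
move=> [L psiL _] gl wb e0 a a0.
have [M M0 gsM] := wedge_bound gl.
have L0 := lipb_ge0 psiL.
have b0 : 0 <= b by exact: le_trans (wb 0%N finset.set0 0).
pose K := L * (M * (k%:R * b)).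
have K0 : 0 <= K by rewrite !mulr_ge0.
have K1 : 0 < K + 1 by rewrite ltr_wpDl.
have [N0 eN] := e0 (a / (K + 1)) (divr_gt0 a0 K1).
exists N0 => N N0N; apply: (@le_trans _ _ (K * (a / (K + 1)))).
  apply: gint_bound => x; rewrite normrM /K -!mulrA ler_pM//.
  have -> : M * (k%:R * (b * (a * (K + 1)^-1))) =
            M * (k%:R * (a * (K + 1)^-1) * b) by ring.
  apply: gsM; apply: ecup_bound => //; first by rewrite divr_ge0 ?ltW.
  by move=> i y; exact: eN.
rewrite mulrCA; apply: ler_piMr; first exact: ltW.
by rewrite ler_pdivrMr// mul1r lerDl.
Qed.

(* Summation by parts: the coboundary moves to [psi]. *)
Lemma wedge_null psi gs1 gs2 (e : nat -> 'I_k -> X -> R) :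
  lipb psi -> cpt psi -> lipb_seq gs1 -> lipb_seq gs2 -> unull e ->
  nullseq (fun N => gint N (fun x => psi x *
    wedgeN N gs1 (cobN N (ecup (shv (hN N)) (e N) (wedgeN N gs2 onek))) setTk x)).
Proof.
move=> psil psi0 gl1 gl2 e0.
have [M2 M20 gs2M] := wedge_bound gl2.
have pgl1 : lipb_seq (psi :: gs1) by [].
have := @wedge_ecup_null (fun=> 1) (psi :: gs1)
  (fun N => wedgeN N gs2 onek) e (M2 * 1) (lipb_cst 1) pgl1
  (fun N => gs2M N 1 onek onec_bound) e0.
apply: (@nullseqM _ 1) => N.
have [b ->] := wedge_cob N.+1%:R (shvC (hN N)) gs1
  (ecup (shv (hN N)) (e N) (wedgeN N gs2 onek)).
rewrite gint_by_parts// normrN /=.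
under [in leRHS]eq_gint do rewrite mul1r.
by rewrite mul1r; case: b => //=; rewrite /dcup ecupN /oppc gintN normrN.
Qed.

Lemma wint_anticomm psi gs1 gs2 u v :
  lipb psi -> cpt psi -> lipb_seq gs1 -> lipb_seq gs2 -> lipb u -> lipb v ->
  nullseq (fun N => wint psi (gs1 ++ [:: u, v & gs2]) N +
                    wint psi (gs1 ++ [:: v, u & gs2]) N).
Proof.
move=> psil psi0 gl1 gl2 [L uL duL] [M vM dvM].
have L0 := lipb_ge0 uL; have M0 := lipb_ge0 vM.
pose e N (i : 'I_k) x : R := - (N.+1%:R * (u (shv (hN N) i x) - u x) *
   (v (shv (hN N) i x) - v x)).
apply: nullseq_ext (@wedge_null psi gs1 gs2 e psil psi0 gl1 gl2 _).
- move=> N; rewrite /wint -gintD; apply: eq_gint => x.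
  rewrite !wedge_cat /= -mulrDr; congr (_ * _).
  rewrite -[RHS]/(addc _ _ _ _) -wedgeD dcup_anticomm; last first.
  + exact/cob_wedge1/shvC.
  + exact: shvC.
  congr (wedge _ _ _ (cob _ _ _) _ _); apply: cochainP => A y.
  rewrite /oppc /ecup -sumrN; apply: eq_bigr => i _; rewrite /e; ring.
- move=> a a0; have [N0 sN] := nullseqZ (L * M) (@nullseq_inv R) a0.
  exists N0 => N i x /sN; apply: le_trans.
  rewrite /e normrN -mulrA normrM gtr0_norm ?ltr0n// normrM.
  rewrite (@ger0_norm _ (L * M * _)) ?mulr_ge0 ?invr_ge0//.
  rewrite -ler_pdivlMl ?ltr0n//.
  rewrite (_ : _^-1 * _ = (L * N.+1%:R^-1) * (M * N.+1%:R^-1)); last by ring.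
  by apply: ler_pM => //; [apply: duL|apply: dvM]; rewrite invr_ge0.
Qed.

Lemma edgeo_unull r : edgeo r -> unull (fun N i x => N.+1%:R * r (hN N) i x).
Proof.
move=> ro a a0; have [h0 h00 rh] := ro a a0.
have h20 : 0 < h0 / 2 by rewrite divr_gt0.
have [N0 hN0] := @nullseq_inv R _ h20.
exists N0 => N i x /hN0; rewrite gtr0_norm ?invr_gt0 ?ltr0n// => hh.
rewrite normrM gtr0_norm ?ltr0n// -ler_pdivlMl ?ltr0n// mulrC.
apply: rh; first by rewrite invr_gt0 ltr0n.
by apply: le_lt_trans hh _; rewrite ltr_pdivrMr// ltr_pMr// ltr1n.
Qed.

Lemma wedge_sum N gs (I : Type) (r : seq I) (w : I -> cochain R k X) :
  wedgeN N gs (fun A x => \sum_(j <- r) w j A x) =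
  (fun A x => \sum_(j <- r) wedgeN N gs (w j) A x).
Proof.
elim: r => [|j r IH].
  rewrite (_ : (fun A x => _) = @zeroc R k X).
    by rewrite wedge0; apply: cochainP => A y; rewrite big_nil.
  by apply: cochainP => A y; rewrite big_nil.
rewrite (_ : (fun A x => _) = addc (w j) (fun A x => \sum_(j <- r) w j A x)).
  by rewrite wedgeD IH; apply: cochainP => A y; rewrite big_cons.
by apply: cochainP => A y; rewrite big_cons.
Qed.

Lemma wint_contact psi gs1 gs2 (I : finType) (u v : I -> X -> R) p :
  lipb psi -> cpt psi -> lipb_seq gs1 -> lipb_seq gs2 ->
  edgeo (fun h i x => \sum_j u j x * (v j (shv h i x) - v j x) +
                      (p (shv h i x) - p x)) ->
  nullseq (fun N => \sum_j wint psi (gs1 ++ [:: u j, v j & gs2]) N).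
Proof.
move=> psil psi0 gl1 gl2 uvo.
have := @wedge_null psi gs1 gs2 _ psil psi0 gl1 gl2 (edgeo_unull uvo).
apply: nullseq_ext => N; rewrite /wint -gint_sum; apply: eq_gint => x.
rewrite -mulr_sumr; congr (_ * _).
have -> : (fun i y => N.+1%:R * (\sum_j u j y *
   (v j (shv (hN N) i y) - v j y) + (p (shv (hN N) i y) - p y))) =
  (fun i y => \sum_j u j y * dif (shv (hN N)) N.+1%:R (v j) i y +
     dif (shv (hN N)) N.+1%:R p i y).
  apply/funext => i; apply/funext => y; rewrite mulrDr mulr_sumr.
  by congr (_ + _); apply: eq_bigr => j _; rewrite /dif mulrCA.
rewrite -dcup_contact; last 2 first.
- exact: shvC.
- exact/cob_wedge1/shvC.
transitivity (wedgeN N gs1 (fun A x => \sum_j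
    dcupN N (u j) (dcupN N (v j) (wedgeN N gs2 onek)) A x) setTk x) => //.
by rewrite wedge_sum; apply: eq_bigr => j _; rewrite wedge_cat.
Qed.

End Grid.

(** * The chain rule under the integral *)

Section Expand.
Variables (R : realType) (k : nat).
Local Notation X := 'rV[R]_k.
Implicit Types (f g u v p psi : X -> R) (gs : seq (X -> R)).
Local Notation hN N := (N.+1%:R^-1 : R).
Local Notation cobN N := (cob (shv (hN N)) N.+1%:R).
Local Notation dcupN N := (dcup (shv (hN N)) N.+1%:R).
Local Notation wedgeN N := (wedge (shv (hN N)) N.+1%:R).
Local Notation onek := (@onec R k X).
Local Notation setTk := [set: 'I_k]%SET.

(** Each cup product reads the coefficient [a] one grid step further, so pulling it to the front
    costs one increment of [a], of the order of the mesh, per factor. *)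
Lemma wedge_scalec_comm a gs : lipb a -> lipb_seq gs -> exists2 M, 0 <= M &
  forall N b w, boundc b w -> boundc (M * b * hN N)
    (addc (wedgeN N gs (scalec a w)) (oppc (scalec a (wedgeN N gs w)))).
Proof.
move=> [La aL daL]; elim: gs => [_|g gs IH [gl gsl]].
  exists 0 => // N b w _ A x.
  by rewrite /addc /oppc subrr normr0 !mul0r.
have La0 := lipb_ge0 aL.
have [M M0 gsM] := IH gsl.
have [Mg Mg0 gM] := dcup_bound gl.
have [M' M'0 gsM'] := wedge_bound gsl.
case: gl => L gL dgL; have L0 := lipb_ge0 gL.
exists (Mg * M + k%:R * (L * La) * M') => [|N b w wb].
  by rewrite addr_ge0 ?mulr_ge0.
have b0 : 0 <= b by exact: le_trans (wb finset.set0 0).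
pose V := wedgeN N gs w.
have -> : addc (wedgeN N (g :: gs) (scalec a w))
    (oppc (scalec a (wedgeN N (g :: gs) w))) =
  addc (dcupN N g (addc (wedgeN N gs (scalec a w)) (oppc (scalec a V))))
    (ecup (shv (hN N)) (fun i x => dif (shv (hN N)) N.+1%:R g i x *
       (a (shv (hN N) i x) - a x)) V).
  rewrite /dcup ecupD ecupN /=; apply: cochainP => A x.
  rewrite /addc /oppc -addrA; congr (_ + _).
  rewrite /scalec /dcup /ecup mulr_sumr -!sumrN -big_split/=.
  by apply: eq_bigr => i _; rewrite /V; ring.
move=> A x; rewrite /addc (le_trans (ler_normD _ _))// !mulrDl lerD//.
  rewrite -!mulrA; apply: gM.
  by rewrite !mulrA; exact: gsM.
have -> : k%:R * (L * La) * M' * b * hN N = k%:R * (L * La * hN N) * (M' * b).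
  by ring.
apply: ecup_bound.
- by rewrite !mulr_ge0 ?invr_ge0.
- move=> i y; rewrite normrM -mulrA ler_pM//; first exact: dif_bound.
  by apply: daL; rewrite invr_ge0.
- exact: gsM'.
Qed.

(** The differential of [g] is a combination of those of the [f a], up to o(h). The coefficients are
    Lipschitz because they end up in the test function. *)
Definition fsmooth (I : finType) (f : I -> X -> R) g := lipb g /\
  exists2 co : I -> X -> R, forall a, lipb (co a) &
    edgeo (fun h i x => g (shv h i x) - g x -
                        \sum_a co a x * (f a (shv h i x) - f a x)).

(** Two errors arise: the o(h) remainder of the expansion ([n1]), and the cost of moving the
    coefficients past [gs1] into the test function ([n2]). *)
Lemma wint_expand psi gs1 gs2 (I : finType) (f co : I -> X -> R) g :
  lipb psi -> lipb_seq gs1 -> lipb_seq gs2 ->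
  (forall a, lipb (f a)) -> (forall a, lipb (co a)) ->
  edgeo (fun h i x => g (shv h i x) - g x -
                      \sum_a co a x * (f a (shv h i x) - f a x)) ->
  nullseq (fun N => wint psi (gs1 ++ g :: gs2) N -
    \sum_a wint (fun x => psi x * co a x) (gs1 ++ f a :: gs2) N).
Proof.
move=> psil gl1 gl2 fl col go.
have [M2 M20 gs2M] := wedge_bound gl2.
pose V N := wedgeN N gs2 onek.
have VM N : boundc (M2 * 1) (V N) by apply: gs2M; exact: onec_bound.
have n1 := wedge_ecup_null psil gl1 VM (edgeo_unull go).
pose s2 a N := gint N (fun x => psi x *
   addc (wedgeN N gs1 (scalec (co a) (dcupN N (f a) (V N))))
        (oppc (scalec (co a) (wedgeN N gs1 (dcupN N (f a) (V N))))) setTk x).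
have n2 : nullseq (fun N => \sum_a s2 a N).
  apply: nullseq_sum => a _.
  have [M M0 comm] := wedge_scalec_comm (col a) gl1.
  have [Mf Mf0 fM] := dcup_bound (fl a).
  case: psil => L psiL _; have L0 := lipb_ge0 psiL.
  apply: (@nullseqM _ (L * (M * (Mf * (M2 * 1))))) (@nullseq_inv R) => N.
  apply: gint_bound => x; rewrite normrM -(mulrA L); apply: ler_pM => //.
  rewrite (@ger0_norm _ (hN N)) ?invr_ge0//.
  by apply: comm; apply: fM.
apply: nullseq_ext (nullseqD n1 n2) => N.
rewrite /s2 -gint_sum -gintD /wint -gint_sum -gintN -gintD.
apply: eq_gint => x.
rewrite wedge_cat /= -/(V N).
under [X in _ - X]eq_bigr do rewrite wedge_cat/= -/(V N) -mulrA.
rewrite -!mulr_sumr -mulrDr -mulrBr; congr (_ * _).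
have -> : dcupN N g (V N) = addc
   (ecup (shv (hN N)) (fun i x => N.+1%:R * (g (shv (hN N) i x) - g x -
      \sum_a co a x * (f a (shv (hN N) i x) - f a x))) (V N))
   (fun A x => \sum_a scalec (co a) (dcupN N (f a) (V N)) A x).
  apply: cochainP => A y; rewrite /addc /scalec /dcup /ecup.
  under [X in _ + X]eq_bigr do rewrite mulr_sumr.
  rewrite exchange_big /= -big_split /=; apply: eq_bigr => i _.
  rewrite /dif.
  have -> : \sum_a co a y * (possgn R i A * (N.+1%:R *
        (f a (shv (hN N) i y) - f a y) * V N (A :\ i) (shv (hN N) i y))) =
      possgn R i A * (N.+1%:R * (\sum_a co a y * (f a (shv (hN N) i y) - f a y)) *
         V N (A :\ i) (shv (hN N) i y)).
    rewrite mulr_sumr mulr_suml mulr_sumr.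
    by apply: eq_bigr => a _; ring.
  by ring.
rewrite wedgeD wedge_sum [in RHS]/addc -addrA; congr (_ + _).
rewrite -sumrB; apply: eq_bigr => a _.
by rewrite /oppc /scalec.
Qed.

Lemma wint_fsmooth (I : finType) (f : I -> X -> R) m :
  (forall a, lipb (f a)) ->
  (forall psi (w : seq I), lipb psi -> cpt psi -> size w = m ->
     nullseq (wint psi (map f w))) ->
  forall psi gs, lipb psi -> cpt psi -> size gs = m ->
    foldr (fun g P => fsmooth f g /\ P) True gs -> nullseq (wint psi gs).
Proof.
move=> fl words psi gs psil psi0 sgs gsf.
(* Factors are expanded from left to right, [w] collecting the letters chosen so far. The test
   function varies in the induction because it absorbs a coefficient each time. *)
suff : forall (w : seq I) gs' psi, lipb psi -> cpt psi ->
    (size w + size gs' = m)%N -> foldr (fun g P => fsmooth f g /\ P) True gs' ->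
    nullseq (wint psi (map f w ++ gs')).
  by move=> /(_ [::] gs psi); exact.
move=> w gs'; elim: gs' w {psi gs psil psi0 sgs gsf}.
  by move=> w psi psil psi0 wm _; rewrite cats0; apply: words => //; rewrite -wm addn0.
move=> g gs IH w psi psil psi0 wm [[gl [co col go]] gsf].
have fwl (v : seq I) : lipb_seq (map f v) by elim: v => //= a v IHv.
have gsl : lipb_seq gs.
  by elim: (gs) gsf => //= g' gs'' IHg [[g'l _] /IHg].
have n1 := wint_expand psil (fwl w) gsl fl col go.
have n2 : nullseq (fun N => \sum_a wint (fun x => psi x * co a x)
    (map f w ++ f a :: gs) N).
  apply: nullseq_sum => a _.
  have := IH (rcons w a) (fun x => psi x * co a x).
  rewrite map_rcons cat_rcons size_rcons; apply => //.
  - exact: lipbM.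
  - by move=> x /psi0 ->; rewrite mul0r.
  - by rewrite -wm /= addSnnS.
by apply: nullseq_ext (nullseqD n1 n2) => N; rewrite subrK.
Qed.

End Expand.

(** * Degree *)

Section Degree.
Variables (R : realType) (k : nat).
Local Notation X := 'rV[R]_k.
Implicit Types (f g u v p psi : X -> R) (gs : seq (X -> R)).
Local Notation hN N := (N.+1%:R^-1 : R).
Local Notation cobN N := (cob (shv (hN N)) N.+1%:R).
Local Notation dcupN N := (dcup (shv (hN N)) N.+1%:R).
Local Notation wedgeN N := (wedge (shv (hN N)) N.+1%:R).
Local Notation difN N := (dif (shv (hN N)) N.+1%:R).
Local Notation onek := (@onec R k X).
Local Notation setTk := [set: 'I_k]%SET.

Definition clamp (t : R) : R := Num.min 1 (Num.max 0 t).

Lemma clamp_lip s t : `|clamp s - clamp t| <= `|s - t|.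
Proof.
rewrite /clamp /Num.min /Num.max; case: (ger0P (s - t)) => st;
  case: (ltP 0 s) => s0; case: (ltP 0 t) => t0; rewrite ?ltr10;
  case: (ltP 1 s) => s1; case: (ltP 1 t) => t1;
  by rewrite ler_norml; apply/andP; split; lra.
Qed.

Lemma clamp_itv t : 0 <= clamp t <= 1.
Proof.
by rewrite /clamp /Num.min /Num.max; case: (ltP 0 t) => t0;
  rewrite ?ltr10; case: (ltP 1 t) => ?; apply/andP; split; lra.
Qed.

Lemma clamp_ge1 t : 1 <= t -> clamp t = 1.
Proof.
by move=> t1; rewrite /clamp /Num.min /Num.max; case: (ltP 0 t) => t0;
  rewrite ?ltr10; case: (ltP 1 t) => ?; lra.
Qed.

Lemma clamp_le0 t : t <= 0 -> clamp t = 0.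
Proof.
by move=> t1; rewrite /clamp /Num.min /Num.max; case: (ltP 0 t) => t0;
  rewrite ?ltr10; case: (ltP 1 t) => ?; lra.
Qed.

(** Slope 6 makes the cutoff equal to 1 on [1/6, 5/6], a margin of 1/6 around the zone between 1/3
    and 2/3 where [plateau] functions vary. *)
Definition tent (t : R) : R := clamp (6 * Num.min t (1 - t)).

Lemma tent_lip (t h : R) : 0 <= h -> `|tent (t + h) - tent t| <= 6 * h.
Proof.
move=> h0; apply: le_trans (clamp_lip _ _) _; rewrite ler_norml /Num.min.
case: (ltP t (1 - t)) => ?; case: (ltP (t + h) _) => ?; apply/andP; split; lra.
Qed.

Lemma tent_bound t : `|tent t| <= 6.
Proof.
have /andP[t0 t1] := clamp_itv (6 * Num.min t (1 - t)).
by rewrite /tent ger0_norm//; lra.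
Qed.

Lemma tent1 t : 6^-1 <= t -> t <= 5 / 6 -> tent t = 1.
Proof.
by move=> t1 t2; apply: clamp_ge1; rewrite /Num.min; case: (ltP t) => ?; lra.
Qed.

Lemma tent0 t : (t <= 0) || (1 <= t) -> tent t = 0.
Proof.
by case/orP => t1; apply: clamp_le0; rewrite /Num.min; case: (ltP t) => ?; lra.
Qed.

Definition cutoff (x : X) : R := \prod_j tent (x 0 j).

Lemma lipb_coord (a : R -> R) j L : (forall t, `|a t| <= L) ->
  (forall t h, 0 <= h -> `|a (t + h) - a t| <= L * h) ->
  @lipb R k (fun x => a (x 0 j)).
Proof.
move=> aL daL; exists L => [x|h i x h0]; first exact: aL.
rewrite shvE; case: eqP => _; rewrite ?mulr1 ?mulr0; first exact: daL.
rewrite addr0 subrr normr0 mulr_ge0//.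
by apply: le_trans (aL 0).
Qed.

Lemma lipb_prod (I : Type) (r : seq I) (f : I -> X -> R) :
  (forall i, lipb (f i)) -> lipb (fun x => \prod_(i <- r) f i x).
Proof.
move=> fl; elim: r => [|i r IH].
  rewrite (_ : (fun x => _) = (fun=> 1)); first exact: lipb_cst.
  by apply/funext => x; rewrite big_nil.
rewrite (_ : (fun x => _) = (fun x => f i x * \prod_(i <- r) f i x)).
  exact: lipbM (fl _) IH.
by apply/funext => x; rewrite big_cons.
Qed.

Lemma lipb_cutoff : lipb cutoff.
Proof.
apply: lipb_prod => j; apply: lipb_coord; first exact: tent_bound.
exact: tent_lip.
Qed.

Lemma cpt_cutoff : cpt cutoff.
Proof. by move=> x [i xi]; rewrite /cutoff (bigD1 i)//= tent0// mul0r. Qed.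

Lemma cutoff1 (x : X) : (forall j, 6^-1 <= x 0 j <= 5 / 6) -> cutoff x = 1.
Proof.
by move=> xj; rewrite /cutoff big1// => j _; have /andP[? ?] := xj j; rewrite tent1.
Qed.

(** The values in between are free, so that the discontinuous [step] qualifies: it is the model for
    which the integral is computed explicitly. *)
Definition plateau j g :=
  (forall x : X, x 0 j <= 3^-1 -> g x = 0) /\
  (forall x : X, 2 / 3 <= x 0 j -> g x = 1).

Definition step j (x : X) : R := (2^-1 <= x 0 j)%R%:R.

Lemma plateau_step j : plateau j (step j).
Proof.
split=> x xj; rewrite /step.
  by case: leP => // ?; exfalso; lra.
by case: leP => // ?; exfalso; lra.
Qed.

(* [far N m j x]: the [j]-th coordinate of [x] stays in the plateaux of a
   [plateau j] function along any [m] grid steps from [x]. *)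
Definition far N m j (x : X) := x 0 j + m%:R * hN N <= 3^-1 \/ 2 / 3 <= x 0 j.

Lemma farS N m j i (x : X) : far N m.+1 j x -> far N m j (shv (hN N) i x).
Proof.
have h0 : 0 <= hN N by rewrite invr_ge0.
rewrite /far shvE -(natr1 m) mulrDl mul1r.
move: (m%:R * hN N) (hN N) h0 => a b b0.
case: eqP => _; rewrite ?mulr1 ?mulr0.
  by case=> ?; [left|right]; lra.
by case=> ?; [left|right]; lra.
Qed.

Lemma far_le N m m' j (x : X) : (m' <= m)%N -> far N m j x -> far N m' j x.
Proof.
move=> mm; case=> [xj|]; [left|by right].
apply: le_trans xj; rewrite lerD2l ler_wpM2r ?invr_ge0//.
by rewrite ler_nat.
Qed.

Lemma plateau_dif N j g i x : plateau j g -> far N 1 j x -> difN N g i x = 0.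
Proof.
move=> [g0 g1] xj; rewrite /dif.
have h0 : 0 <= hN N by rewrite invr_ge0.
have := shvE (hN N) i x j; move: xj; rewrite /far mul1r.
set y := shv _ i x; move: (hN N) h0 y => h h0 y xj yj.
have xyj : x 0 j <= y 0 j <= x 0 j + h.
  by rewrite yj; case: eqP => _; rewrite ?mulr1 ?mulr0; apply/andP; split; lra.
case: xj => xj; first by rewrite !g0 ?subrr ?mulr0//; lra.
by rewrite !g1 ?subrr ?mulr0//; lra.
Qed.

Definition zero_far N m j (w : cochain R k X) :=
  forall A x, far N m j x -> w A x = 0.

Lemma zero_far_dcup N m j g w :
  zero_far N m j w -> zero_far N m.+1 j (dcupN N g w).
Proof.
move=> w0 A x xj; rewrite /dcup /ecup big1// => i _.
by rewrite w0 ?mulr0//; exact: farS.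
Qed.

Lemma zero_far_wedge N m j gs w :
  zero_far N m j w -> zero_far N (size gs + m) j (wedgeN N gs w).
Proof. by move=> w0; elim: gs => //= g gs IH; exact: zero_far_dcup. Qed.

Lemma zero_far_le N m m' j w : (m <= m')%N ->
  zero_far N m j w -> zero_far N m' j w.
Proof. by move=> mm w0 A x /(far_le mm) /w0. Qed.

Lemma zero_far_plateau N j g w : plateau j g -> zero_far N 1 j (dcupN N g w).
Proof.
move=> gp A x xj; rewrite /dcup /ecup big1// => i _.
by rewrite (plateau_dif _ gp xj) mul0r mulr0.
Qed.

Lemma zero_far_mem N j (l : seq 'I_k) (F : 'I_k -> X -> R) w :
  (forall i, plateau i (F i)) -> j \in l ->
  zero_far N (size l) j (wedgeN N (map F l) w).
Proof.
move=> Fp; elim: l => //= i l IH; rewrite inE => /predU1P[<-|jl].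
  by apply: zero_far_le (zero_far_plateau _ (Fp j)).
exact/zero_far_dcup/IH.
Qed.

(* The difference of the integrands is the cutoff times a coboundary whose
   primitive vanishes wherever the cutoff is not constant. *)
Lemma wint_replace N (l1 l2 : seq 'I_k) j (F G : 'I_k -> X -> R) g g' :
  (forall i, plateau i (F i)) -> (forall i, plateau i (G i)) ->
  plateau j g -> plateau j g' -> (forall i, i \in l1 ++ j :: l2) ->
  (size (l1 ++ j :: l2)).+2%:R * hN N <= 6^-1 ->
  wint cutoff (map F l1 ++ g :: map G l2) N =
  wint cutoff (map F l1 ++ g' :: map G l2) N.
Proof.
move=> Fp Gp gp g'p all_l Nbig; have h0 : 0 <= hN N by rewrite invr_ge0.
apply/eqP; rewrite -subr_eq0 /wint -gintN -gintD; apply/eqP.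
pose W := wedgeN N (map G l2) onek.
pose u x := g x - g' x.
have W0 : cobN N W = @zeroc _ _ _ by apply/cob_wedge1/shvC.
have [b Vb] := wedge_cob N.+1%:R (shvC (hN N)) (map F l1) (scalec u W).
pose V := if b then oppc (wedgeN N (map F l1) (scalec u W))
          else wedgeN N (map F l1) (scalec u W).
rewrite -/V in Vb.
transitivity (gint N (fun x => cutoff x * cobN N V setTk x)).
  apply: eq_gint => x; rewrite !wedge_cat /= -/W -mulrBr -Vb; congr (_ * _).
  rewrite cob_scalec W0.
  have -> : addc (dcupN N u W) (scalec u (@zeroc _ _ _)) =
    addc (dcupN N g W) (oppc (dcupN N g' W)).
    apply: cochainP => A y; rewrite /addc /scalec /zeroc /oppc mulr0 addr0.
    rewrite /dcup /ecup -sumrB; apply: eq_bigr => i _; rewrite /dif /u; ring.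
  by rewrite wedgeD wedge_oppc.
rewrite gint_by_parts; last exact: cpt_cutoff.
rewrite (_ : gint _ _ = 0) ?oppr0// /gint big1 ?mulr0// => z _.
(* Every direction occurs in the list. Far out in a direction from [l1] or [l2] a factor has zero
   differential; in direction [j], [g] and [g'] are on the same plateau and [u] vanishes. *)
have uW i : zero_far N (size (l1 ++ j :: l2)) i V.
  have : zero_far N (size (l1 ++ j :: l2)) i (wedgeN N (map F l1) (scalec u W)).
    have : i \in l1 ++ j :: l2 by exact: all_l.
    rewrite mem_cat inE => /or3P[il|/eqP->|il].
    - apply: zero_far_le (zero_far_mem _ Fp il).
      by rewrite size_cat leq_addr.
    - have uW0 : zero_far N 1 j (scalec u W).
        move=> A x xj; rewrite /scalec /u.
        case: gp => g0 g1; case: g'p => g'0 g'1.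
        have [] := far_le (leq0n 1) xj; rewrite ?mul0r ?addr0 => xj'.
          by rewrite g0 ?g'0 ?subr0 ?mul0r.
        by rewrite g1 ?g'1// subrr mul0r.
      have := @zero_far_wedge N _ _ (map F l1) _ uW0; rewrite size_map.
      by apply: zero_far_le; rewrite size_cat leq_add2l.
    - have uW0 : zero_far N (size l2) i (scalec u W).
        by move=> A x xi; rewrite /scalec /W (zero_far_mem _ Gp il)// mulr0.
      have := @zero_far_wedge N _ _ (map F l1) _ uW0; rewrite size_map.
      by apply: zero_far_le; rewrite size_cat leq_add2l.
  by rewrite /V; case: (b) => // V0 A x /V0; rewrite /oppc => ->; rewrite oppr0.
rewrite /dcup /ecup big1// => i _.
have := fun j' => shvE (hN N) i (@pt R k N z) j'.
set y := shv _ i _; move: Nbig.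
rewrite -(natr1 (size _).+1) -(natr1 (size _)) !mulrDl !mul1r.
have := uW.
have s0 : 0 <= (size (l1 ++ j :: l2))%:R * hN N by rewrite mulr_ge0.
rewrite /zero_far /far /dif -/y.
move: ((size (l1 ++ j :: l2))%:R * hN N) (hN N) (@pt R k N z) y h0 s0
  => m h x y h0 m0 {}uW Nbig yE.
have xy j' : x 0 j' <= y 0 j' <= x 0 j' + h.
  by rewrite yE; case: eqP => _; rewrite ?mulr1 ?mulr0; apply/andP; split; lra.
(* On this box the cutoff is 1 at both ends of the edge. Off it some coordinate is so far out that
   [V] vanishes at [y]; the margin 1/6 pays for the grid steps. *)
have [xbox|] := pselect (forall j', 6^-1 <= x 0 j' <= 5 / 6 - h).
  rewrite !cutoff1 ?subrr ?mulr0 ?mul0r ?mulr0// => j'.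
    by have := xbox j' => /andP[? ?]; apply/andP; split; lra.
  have := xbox j'; have := xy j' => /andP[? ?] /andP[? ?].
  by apply/andP; split; lra.
move=> /existsNP[j' /negP]; rewrite negb_and -!ltNge => xj.
rewrite (uW j') ?mulr0//.
by have /andP[? ?] := xy j'; case/orP: xj => xj; [left|right]; lra.
Qed.

Lemma wint_step N (F : 'I_k -> X -> R) :
  (forall i, plateau i (F i)) -> k.+2%:R * hN N <= 6^-1 ->
  wint cutoff (map F (enum 'I_k)) N = wint cutoff (map step (enum 'I_k)) N.
Proof.
move=> Fp Nbig.
suff : forall l1 l2, l1 ++ l2 = enum 'I_k ->
    wint cutoff (map step l1 ++ map F l2) N = wint cutoff (map step (l1 ++ l2)) N.
  by move=> /(_ [::] (enum 'I_k) erefl).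
move=> l1 l2; elim: l2 l1 => [|j l2 IH] l1 l12; first by rewrite cats0 cats0.
rewrite /= (@wint_replace N l1 l2 j step F (F j) (step j))//.
- by rewrite -cat_rcons -map_rcons IH ?cat_rcons.
- exact: plateau_step.
- exact: plateau_step.
- by move=> i; rewrite l12 mem_enum.
- by rewrite l12 size_enum_ord.
Qed.

Lemma dif_step_eq0 N j i x : i != j -> difN N (step j) i x = 0.
Proof.
by move=> ij; rewrite /dif /step shvE eq_sym (negbTE ij) mulr0 addr0 subrr mulr0.
Qed.

Lemma dif_step_shv N j i x : i != j ->
  difN N (step j) j (shv (hN N) i x) = difN N (step j) j x.
Proof.
by move=> ij; rewrite /dif /step !shvE eq_sym (negbTE ij) mulr0 !addr0.
Qed.

(** [step j] changes only along direction [j], so a single assignment of directions to factors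
    survives; the list being increasing, its sign is +1. *)
Lemma wedge_step N (l : seq 'I_k) A x :
  pairwise (fun i j : 'I_k => (i < j)%N) l ->
  wedgeN N (map step l) onek A x =
  (A == [set i in l])%:R * \prod_(j <- l) difN N (step j) j x.
Proof.
elim: l A x => [|i l IH] A x.
  move=> _; rewrite big_nil mulr1 /= /onec.
  have -> // : [set i in [::]] = finset.set0 :> {set 'I_k}.
  by apply/setP => j; rewrite !inE.
rewrite pairwise_cons => /andP[/allP il lp] /=; rewrite big_cons.
have iNl : i \notin l by apply/negP => /il; rewrite ltnn.
have -> : dcupN N (step i) (wedgeN N (map step l) onek) A x =
   if i \in A then possgn R i A * (difN N (step i) i x *
     wedgeN N (map step l) onek (A :\ i) (shv (hN N) i x)) else 0.
  rewrite /dcup /ecup; case: ifPn => iA; last first.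
    by rewrite big1// => j jA; rewrite dif_step_eq0 ?mul0r ?mulr0//;
      apply: contra iA => /eqP <-.
  rewrite (bigD1 i)//= big1 ?addr0// => j /andP[_ ji].
  by rewrite dif_step_eq0// mul0r mulr0.
case: ifPn => iA; last first.
  rewrite (_ : (A == _) = false) ?mul0r//; apply/eqP => AE.
  by move: iA; rewrite AE !inE eqxx.
rewrite IH// (_ : (A :\ i == _) = (A == [set j in i :: l])); last first.
  apply/eqP/eqP => [Al|->].
    apply/setP => j; rewrite -(finset.setD1K iA) Al !inE.
    by [].
  apply/setP => j; rewrite !inE; case: eqP => //= ->.
  by rewrite (negbTE iNl).
case: eqP => [AE|_]; last by rewrite !mul0r !mulr0.
rewrite !mul1r (_ : possgn R i A = 1) ?mul1r; last first.
  rewrite /possgn (_ : [set _ in _ | _] = finset.set0) ?cards0 ?expr0//.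
  apply/setP => j; rewrite AE !inE; case: eqP => [->|_] /=; first by rewrite ltnn.
  by apply/negbTE/negP => /andP[/il ij ji]; move: (ltn_trans ij ji); rewrite ltnn.
congr (_ * _); apply: eq_big_seq => j jl; apply: dif_step_shv.
by apply: contraNneq iNl => ->.
Qed.

(** After the reduction to [step] the cutoff is 1 wherever the product is nonzero, and the sum
    factors into one-dimensional telescoping sums. *)
Lemma wint_plateau N (F : 'I_k -> X -> R) :
  (forall i, plateau i (F i)) -> k.+2%:R * hN N <= 6^-1 ->
  wint cutoff (map F (enum 'I_k)) N = 1.
Proof.
move=> Fp Nbig; rewrite wint_step// /wint.
have h0 : 0 <= hN N by rewrite invr_ge0.
have h6 : hN N <= 6^-1.
  apply: le_trans Nbig; rewrite -[leLHS]mul1r ler_wpM2r//.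
  by rewrite ler1n.
have enum_pw : pairwise (fun i j : 'I_k => (i < j)%N) (enum 'I_k).
  rewrite -(pairwise_map (fun i : 'I_k => val i) ltn) val_enum_ord.
  by rewrite -sorted_pairwise ?iota_ltn_sorted//; exact: ltn_trans.
transitivity (gint N (fun x => \prod_j difN N (step j) j x)).
  apply: eq_gint => x; rewrite wedge_step// (_ : (_ == _) = true); last first.
    by apply/eqP/setP => j; rewrite !inE mem_enum.
  rewrite mul1r big_enum /=.
  have [xin|] := pselect (forall j, 6^-1 <= x 0 j <= 5 / 6).
    by rewrite cutoff1// mul1r.
  move=> /existsNP[j xj].
  rewrite (bigD1 j)//= (plateau_dif j (plateau_step j)) ?mul0r ?mulr0//.
  move/negP : xj; rewrite negb_and -!ltNge /far mul1r.
  move: (hN N) h6 => h h6.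
  by case/orP => ?; [left|right]; lra.
rewrite /gint.
pose a (j : 'I_k) (z : 'I_N.+1) : R := N.+1%:R *
  ((2^-1 <= (z.+1)%:R / N.+1%:R :> R)%:R - (2^-1 <= (z : nat)%:R / N.+1%:R :> R)%:R).
have -> : \sum_z \prod_j difN N (step j) j (@pt R k N z) =
    \prod_(j < k) \sum_(z < N.+1) a j z.
  rewrite bigA_distr_bigA /=; apply: eq_bigr => z _; apply: eq_bigr => j _.
  rewrite /dif /step /a shvE eqxx mulr1 mxE.
  by rewrite -(natr1 (z j)) mulrDl mul1r.
have -> : \prod_(j < k) \sum_(z < N.+1) a j z = \prod_(j < k) N.+1%:R.
  apply: eq_bigr => j _; rewrite -mulr_sumr.
  pose b (z : nat) : R := (2^-1 <= z%:R / N.+1%:R :> R)%:R.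
  rewrite (_ : \sum_(z < N.+1) _ = \sum_(0 <= z < N.+1) (b z.+1 - b z)).
    have b1 : b N.+1 = 1.
      rewrite /b divff ?pnatr_eq0// (_ : 2^-1 <= 1 :> R)//.
      by rewrite invf_le1// ler1n.
    have b0 : b 0%N = 0.
      rewrite /b mul0r (_ : (2^-1 <= 0 :> R) = false)//.
      by apply/negbTE; rewrite -ltNge invr_gt0.
    by rewrite telescope_sumr// b1 b0 subr0 mulr1.
  by rewrite big_mkord.
rewrite prodr_const card_ord mulVf// expf_neq0 ?pnatr_eq0//.
Qed.

End Degree.

(** * The Lefschetz argument *)

Section Words.
(** [P] is a subgroup with torsion-free quotient, later the null sequences. The letters (j, false)
    and (j, true) stand for dx_j and dy_j, and [T_contr] kills the symplectic form. *)
Variables (n : nat) (V : zmodType) (P : V -> Prop).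
Hypothesis P0 : P 0.
Hypothesis PD : forall v w, P v -> P w -> P (v + w).
Hypothesis PN : forall v, P v -> P (- v).
Hypothesis Pdiv : forall v m, (0 < m)%N -> P (v *+ m) -> P v.
Local Notation letter := ('I_n * bool)%type.
Implicit Types (s p q w : seq letter) (l : seq {set 'I_n}).
Variable T : seq letter -> V.
Hypothesis T_alt : forall p a b s, P (T (p ++ [:: a, b & s]) + T (p ++ [:: b, a & s])).
Hypothesis T_contr : forall p s,
  P (\sum_j T (p ++ [:: (j, false), (j, true) & s])).

Lemma P_sum (I : Type) (r : seq I) (Q : pred I) (F : I -> V) :
  (forall i, Q i -> P (F i)) -> P (\sum_(i <- r | Q i) F i).
Proof. by move=> FP; apply: (big_ind P). Qed.

Lemma PB (v u : V) : P v -> P (v - u) -> P u.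
Proof.
move=> Pv /PN Pvw; have := PD Pvw Pv.
by rewrite opprB subrK.
Qed.

Lemma PA (v u : V) : P v -> P (v + u) -> P u.
Proof. by move=> Pv Pvw; have := PD Pvw (PN Pv); rewrite addrAC subrr add0r. Qed.

(** A transposition only changes the sign modulo [P], and [P] is stable under negation, so no
    signature is tracked. *)
Lemma P_perm p s t : perm_eq s t -> P (T (p ++ t)) -> P (T (p ++ s)).
Proof.
elim: s p t => [|a s IH] p t st Pt.
  by rewrite perm_sym in st; move: Pt; rewrite (perm_nilP st).
have at_ : a \in t by rewrite -(perm_mem st) mem_head.
move: st Pt; case/splitPr: at_ => t1 t2 st Pt.
rewrite -cat_rcons; apply: (IH _ (t1 ++ t2)).
  rewrite -(perm_cons a); apply: perm_trans st _.
  by rewrite perm_catC /= perm_cons perm_catC.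
rewrite cat_rcons; elim: t1 p Pt {st} => //= b t1 IHt p Pt.
have := IHt (rcons p b); rewrite !cat_rcons => /(_ Pt) Pab.
by apply: PA Pab (T_alt _ _ _ _).
Qed.

Lemma P_repeat w : ~~ uniq w -> P (T w).
Proof.
elim: w (erefl w) => // a s _ _.
suff H : forall p w, ~~ uniq w -> P (T (p ++ w)) by exact: (H [::]).
move=> p w; elim: w p => //= b w IH p; rewrite negb_and negbK => /orP[bw|].
  have wE := perm_to_rem bw.
  apply: (@P_perm p _ [:: b, b & rem b w]); first by rewrite perm_cons.
  by apply: (@Pdiv _ 2) => //; rewrite mulr2n; exact: T_alt.
by rewrite -cat_rcons; exact: IH.
Qed.

(** Two-forms commute: the exchange is a product of four transpositions. The sign matters here,
    since such values are added up in [psum_fact]. *)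
Lemma P_pairswap p a b c d s :
  P (T (p ++ [:: a, b, c, d & s]) - T (p ++ [:: c, d, a, b & s])).
Proof.
have h1 := T_alt (rcons p a) b c (d :: s).
have h2 := T_alt p a c [:: b, d & s].
have h3 := T_alt (p ++ [:: c; a]) b d s.
have h4 := T_alt (rcons p c) a d (b :: s).
rewrite !cat_rcons in h1 h4; rewrite -!catA /= in h3.
have := PD (PD h1 (PN h2)) (PD h3 (PN h4)).
rewrite !opprD.
set t1 := T _; set t2 := T _; set t3 := T _; set t4 := T _; set t5 := T _.
have -> : t1 + t2 + (- t2 - t3) + (t3 + t4 + (- t4 - t5)) = t1 - t5.
  by rewrite !addrA !addrK subrK.
by [].
Qed.

Definition pair j : seq letter := [:: (j, false); (j, true)].
Definition pairs (l : seq 'I_n) : seq letter := flatten (map pair l).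

Lemma P_pairfront p j (l1 : seq 'I_n) s :
  P (T (p ++ pairs l1 ++ pair j ++ s) - T (p ++ pair j ++ pairs l1 ++ s)).
Proof.
elim: l1 p => [|i l1 IH] p; first by rewrite subrr.
have := PD (IH (p ++ pair i)) (P_pairswap p (i, false) (i, true) (j, false)
   (j, true) (pairs l1 ++ s)).
by rewrite -!catA /= addrA subrK.
Qed.

(** The value of [T] on p omega_M1 ... omega_Mr s, where omega_M is the sum of dx_j dy_j over j in
    M. *)
Fixpoint psum l p s : V :=
  if l is M :: l' then \sum_(j in M) psum l' (p ++ pair j) s else T (p ++ s).

Lemma psum_repeat l p s : ~~ uniq (p ++ s) -> P (psum l p s).
Proof.
elim: l p => [|M l IH] p ps /=; first exact: P_repeat.
apply: P_sum => j _; apply: IH; apply: contra ps.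
by apply: subseq_uniq; rewrite -catA cat_subseq// suffix_subseq.
Qed.

Lemma psum_contr l p q s : P (\sum_j psum l (p ++ pair j ++ q) s).
Proof.
elim: l q => [|M l IH] q /=.
  by under eq_bigr do rewrite -!catA /=; exact: T_contr.
rewrite exchange_big /=; apply: P_sum => i _.
by under eq_bigr do rewrite -!catA; exact: IH.
Qed.

Section Complement.
Variables (M E : {set 'I_n}) (s : seq letter).
Hypothesis ME : [disjoint M & E].
Hypothesis sME : forall j, j \notin M -> j \notin E ->
  ((j, false) \in s) || ((j, true) \in s).

(** The symplectic form splits over [M], [E] and the other indices. The latter contribute
    repetitions, as [s] contains a letter of each; hence omega_M = - omega_E in front of [s]. *)
Lemma psum_swap l p : P (psum (M :: l) p s + psum (E :: l) p s).
Proof.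
have := psum_contr l p [::] s; under eq_bigr do rewrite cats0.
rewrite (bigID (mem (M :|: E)))/= addrC => h.
rewrite /= -bigU//= (eq_bigl (fun i => i \in M :|: E)); last first.
  by move=> i; rewrite !inE.
apply: (PA _ h).
apply: P_sum => j; rewrite !inE negb_or => /andP[jM jE].
apply: psum_repeat; rewrite -catA cat_uniq !negb_and.
by case/orP: (sME jM jE) => js; rewrite /= !inE ?negb_and ?negbK js ?orbT.
Qed.

Lemma psum_swap_at a l p :
  P (psum (nseq a E ++ M :: l) p s + psum (nseq a E ++ E :: l) p s).
Proof.
elim: a p => [|a IH] p /=; first exact: psum_swap.
by rewrite -big_split /=; apply: P_sum => j _; exact: IH.
Qed.

Lemma psum_pigeonhole a (D : {set 'I_n}) p : D \subset E ->
  (forall j, j \in D -> (j, true) \in p) -> (#|E| < a + #|D|)%N ->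
  P (psum (nseq a E) p s).
Proof.
elim: a D p => [|a IH] D p DE Dp aE /=.
  by have := subset_leq_card DE; lia.
apply: P_sum => j jE; have [jD|jD] := boolP (j \in D).
  apply: psum_repeat; rewrite -catA cat_uniq negb_and; apply/orP; right.
  by rewrite negb_and /= (Dp _ jD) orbT.
apply: (IH (j |: D)).
- by rewrite finset.subUset finset.sub1set jE.
- by move=> i; rewrite in_setU1 mem_cat => /orP[/eqP->|/Dp->//];
    rewrite !inE eqxx !orbT.
- by rewrite cardsU1 jD; lia.
Qed.

(** [a] counts the factors already turned from [M] into [E]; at the end more than #|E| factors come
    from [E]. *)
Lemma psum_null a b : (#|E| < a + b)%N ->
  P (psum (nseq a E ++ nseq b M) [::] s).
Proof.
elim: b a => [|b IH] a ab.
  by rewrite cats0; apply: (@psum_pigeonhole a finset.set0); rewrite ?finset.sub0set//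
    ?cards0// => j; rewrite inE.
have := psum_swap_at a (nseq b M) [::]; rewrite addrC; apply: PA.
have -> : nseq a E ++ E :: nseq b M = nseq a.+1 E ++ nseq b M.
  by rewrite -cat_rcons; congr (_ ++ _); elim: (a) => //= a' ->.
by apply: IH; lia.
Qed.

(** [l] is the part of [M] not yet in the prefix. Only its m! orderings avoid a repetition, and they
    have equal values because pairs commute. *)
Lemma psum_fact m (l : seq 'I_n) p : uniq l -> size l = m ->
  {subset l <= M} ->
  (forall j, j \in M -> j \notin l -> (j, true) \in p) ->
  P (psum (nseq m M) p s - T (p ++ pairs l ++ s) *+ m`!).
Proof.
elim: m l p => [|m IH] l p ul lm lM Mp.
  by move/size0nil: lm => -> /=; rewrite subrr.
rewrite /= (bigID (mem l)) /= -addrA addrC -addrA; apply: PD.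
  apply: P_sum => j /andP[jM jl]; apply: psum_repeat.
  rewrite -catA cat_uniq negb_and; apply/orP; right.
  by rewrite negb_and /= (Mp _ jM jl) orbT.
have -> : T (p ++ pairs l ++ s) *+ m.+1`! =
   \sum_(j in M | j \in l) T (p ++ pairs l ++ s) *+ m`!.
  rewrite [RHS](eq_bigl (fun j => j \in l)); last first.
    by move=> j; apply/andP/idP => [[]//|jl]; split => //; exact: lM.
  by rewrite sumr_const (card_uniqP ul) lm factS -mulrnA mulnC.
rewrite addrC -sumrB; apply: P_sum => j /andP[jM jl].
have [l1 [l2 ll]] : exists l1 l2 : seq 'I_n, l = l1 ++ j :: l2.
  by case/splitPr: jl => l1 l2; exists l1, l2.
have ur : uniq (l1 ++ l2) /\ j \notin l1 ++ l2.
  by move: ul; rewrite ll uniq_catC /= uniq_catC mem_cat orbC -mem_cat => /andP[].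
have {}IH := IH (l1 ++ l2) (p ++ pair j) ur.1.
have : P (psum (nseq m M) (p ++ pair j) s -
          T ((p ++ pair j) ++ pairs (l1 ++ l2) ++ s) *+ m`!).
  apply: IH.
  - by move: lm; rewrite ll !size_cat /=; lia.
  - by move=> i; rewrite mem_cat => il; apply: lM; rewrite ll mem_cat inE orbCA il orbT.
  - move=> i iM; rewrite mem_cat => il; rewrite mem_cat.
    have [->|ij] := eqVneq i j; first by rewrite !inE eqxx !orbT.
    by rewrite Mp// ll mem_cat inE (negbTE ij).
have := P_pairfront p j l1 (pairs l2 ++ s).
have -> : pairs l = pairs l1 ++ pair j ++ pairs l2.
  by rewrite ll /pairs map_cat flatten_cat.
have -> : pairs (l1 ++ l2) = pairs l1 ++ pairs l2.
  by rewrite /pairs map_cat flatten_cat.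
rewrite -!catA.
set t1 := T _; set t2 := T _; move=> h1 h2.
have h3 : P ((t2 - t1) *+ m`!).
  have : P (t2 - t1) by rewrite -opprB; exact: PN.
  by move=> h; elim: (m`!) => [|q IHq]; rewrite ?mulr0n// mulrS; exact: PD.
have := PD h2 h3; rewrite mulrnBl addrA subrK.
by [].
Qed.

End Complement.

(* Let M, E and s consist of the indices occurring twice, the indices not
   occurring, and the letters whose partner does not occur: #|E| < #|M|. Modulo P
   the sum over E is the opposite of the sum over M, so the sum over M^#|M|, which
   is #|M|! T(w), is up to sign the sum over E^#|M|, all terms of which have a
   repetition. *)
Lemma long_word_null w : (n < size w)%N -> P (T w).
Proof.
move=> nw; have [uw|] := boolP (uniq w); last exact: P_repeat.
pose M := [set j | ((j, false) \in w) && ((j, true) \in w)].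
pose E := [set j | ((j, false) \notin w) && ((j, true) \notin w)].
pose s := [seq a <- w | a.1 \notin M].
have EM : (#|E| < #|M|)%N.
  have wE : size w = (\sum_j (((j, false) \in w) + ((j, true) \in w)))%N.
    rewrite -(card_uniqP uw) -sum1_card.
    rewrite (eq_bigl (fun a : letter => ((a.1, a.2) \in w)))/=; last by case.
    rewrite -(pair_big_dep xpredT (fun j b => (j, b) \in w) (fun _ _ => 1%N)) /=.
    by apply: eq_bigr => j _; rewrite big_mkcond big_bool /= addnC; do 2 case: (_ \in _).
  (* The two sides agree index by index: both are 1, 1, 2 for an index occurring 0, 1, 2 times. *)
  have : (size w + #|E| = n + #|M|)%N.
    rewrite wE -!sum1_card (big_mkcond (fun j => j \in E)) (big_mkcond (fun j => j \in M)) /=.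
    have nE : (\sum_(j < n) 1)%N = n by rewrite sum1_card card_ord.
    rewrite -[X in _ = (X + _)%N]nE -!big_split /=; apply: eq_bigr => j _; rewrite !inE.
    by case: (_ \in w); case: (_ \in w).
  by lia.
have perm_w : perm_eq w (pairs (enum M) ++ s).
  have pm : forall a, a \in pairs (enum M) = (a.1 \in M).
    case=> j b; apply/flatten_mapP/idP => /=.
      by case=> i; rewrite mem_enum => iM; rewrite !in_cons orbF => /orP[]/eqP[-> _].
    by move=> jM; exists j; rewrite ?mem_enum// !in_cons; case: b; rewrite eqxx ?orbT.
  apply: uniq_perm => //.
    rewrite cat_uniq (filter_uniq _ uw) andbT; apply/andP; split.
      rewrite /pairs; have : uniq (enum M) := enum_uniq _.
      elim: (enum M) => //= j l IH /andP[jl ul].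
      have jNl b : ((j, b) \in flatten (map pair l)) = false.
        apply/negbTE/negP => /flatten_mapP[i il].
        by rewrite !in_cons orbF => /orP[]/eqP[ij]; rewrite ij il in jl.
      by rewrite in_cons !jNl IH// orbF xpair_eqE andbF.
    apply/hasPn => a; rewrite mem_filter => /andP[aM _].
    by rewrite /= pm.
  move=> a; rewrite mem_cat pm mem_filter; case: (boolP (a.1 \in M)) => //= aM.
  by case: a aM => j b /=; rewrite inE => /andP[? ?]; case: b.
apply: (@P_perm [::] _ _ perm_w); rewrite cat0s.
have ME : [disjoint M & E].
  rewrite disjoint_subset; apply/fintype.subsetP => j; rewrite !inE.
  by case/andP => -> _.
have sME j : j \notin M -> j \notin E -> ((j, false) \in s) || ((j, true) \in s).
  move=> jM jE; rewrite /s !mem_filter /= jM /=.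
  by move: jE; rewrite inE negb_and !negbK.
have := @psum_null M E s ME sME 0 #|M|; rewrite add0n => /(_ EM) /= h.
have h2 := @psum_fact M E s ME #|M| (enum M) [::] (enum_uniq _) (esym (cardE _)).
apply: (@Pdiv _ (#|M|)`!); first exact: fact_gt0.
apply: (PB h); apply: h2 => j; first by rewrite mem_enum.
by move=> jM; rewrite mem_enum jM.
Qed.

End Words.

(** * Functions whose differential is spanned by given differentials *)

Section Edgeo.
Variables (R : realType) (k : nat).
Local Notation X := 'rV[R]_k.
Implicit Types (r : R -> 'I_k -> X -> R) (f g : X -> R).

Lemma edgeo_le r r' : (forall h i x, 0 < h -> `|r' h i x| <= `|r h i x|) ->
  edgeo r -> edgeo r'.
Proof.
move=> rr ro e e0; have [h0 h00 rh] := ro e e0; exists h0 => // h i x h1 h2.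
exact: le_trans (rr _ _ _ h1) (rh _ _ _ h1 h2).
Qed.

Lemma edgeo_ext r r' : (forall h i x, r' h i x = r h i x) -> edgeo r -> edgeo r'.
Proof. by move=> rr; apply: edgeo_le => h i x _; rewrite rr. Qed.

Lemma edgeo0 : edgeo (fun (_ : R) (_ : 'I_k) (_ : X) => 0 : R).
Proof. by move=> e e0; exists 1 => // h i x h0 _; rewrite normr0 mulr_ge0// ltW. Qed.

Lemma edgeoD r r' : edgeo r -> edgeo r' -> edgeo (fun h i x => r h i x + r' h i x).
Proof.
move=> ro ro' e e0; have e20 : 0 < e / 2 by rewrite divr_gt0.
have [h1 h10 rh] := ro _ e20; have [h2 h20 rh'] := ro' _ e20.
exists (Num.min h1 h2); first by rewrite lt_min h10.
move=> h i x h0; rewrite lt_min => /andP[hh1 hh2].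
rewrite (le_trans (ler_normD _ _))// [e in leRHS]splitr mulrDl lerD//.
  exact: rh.
exact: rh'.
Qed.

Lemma edgeoM r g M : (forall x, `|g x| <= M) -> edgeo r ->
  edgeo (fun h i x => g x * r h i x).
Proof.
move=> gM ro e e0.
have M1 : 0 < `|M| + 1 by rewrite ltr_wpDl.
have [h0 h00 rh] := ro _ (divr_gt0 e0 M1); exists h0 => // h i x h1 h2.
rewrite normrM; apply: (@le_trans _ _ ((`|M| + 1) * (e / (`|M| + 1) * h))).
  apply: ler_pM => //; last exact: rh.
  by apply: le_trans (gM x) _; rewrite (le_trans (ler_norm _))// lerDl.
by rewrite mulrA (mulrC (_ + 1)) divfK// gt_eqF.
Qed.

Lemma edgeo_sum (I : Type) (s : seq I) (r : I -> R -> 'I_k -> X -> R) :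
  (forall a, edgeo (r a)) -> edgeo (fun h i x => \sum_(a <- s) r a h i x).
Proof.
move=> ro; elim: s => [|a s IH].
  by apply: edgeo_ext edgeo0 => h i x; rewrite big_nil.
by apply: edgeo_ext (edgeoD (ro a) IH) => h i x; rewrite big_cons.
Qed.

Lemma edgeo_sq r K : 0 <= K ->
  (forall h i x, 0 < h -> `|r h i x| <= K * h * h) -> edgeo r.
Proof.
move=> K0 rK e e0; have K1 : 0 < K + 1 by rewrite ltr_wpDl.
exists (e / (K + 1)); first exact: divr_gt0.
move=> h i x h0; rewrite ltr_pdivlMr// => hK.
apply: le_trans (rK _ _ _ h0) _; rewrite ler_wpM2r ?(ltW h0)//.
by rewrite mulrDr mulr1 in hK; rewrite mulrC; lra.
Qed.

Lemma lipb_dif2 f g : lipb f -> lipb g -> edgeo (fun h i x =>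
  (f (shv h i x) - f x) * (g (shv h i x) - g x)).
Proof.
move=> [L fL dfL] [M gM dgM].
apply: (@edgeo_sq _ (L * M)); first by rewrite mulr_ge0 ?(lipb_ge0 fL) ?(lipb_ge0 gM).
move=> h i x h0; rewrite normrM.
have -> : L * M * h * h = (L * h) * (M * h) by ring.
by apply: ler_pM => //; [apply: dfL|apply: dgM]; exact: ltW.
Qed.

Variables (I : finType) (fl : I -> X -> R).
Hypothesis fl_lip : forall a, lipb (fl a).
Local Notation smooth := (fsmooth fl).

Lemma smooth_cst c : smooth (fun=> c).
Proof.
split; first exact: lipb_cst.
exists (fun _ => fun=> 0) => [a|]; first exact: lipb_cst.
apply: edgeo_ext edgeo0 => h i x; rewrite subrr big1 ?subr0// => a _.
by rewrite mul0r.
Qed.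

Lemma smooth_fl a : smooth (fl a).
Proof.
split; first exact: fl_lip.
exists (fun b => fun=> (b == a)%:R) => [b|]; first exact: lipb_cst.
apply: edgeo_ext edgeo0 => h i x; rewrite (bigD1 a)//= eqxx mul1r big1.
  by rewrite addr0 subrr.
by move=> b /negbTE ->; rewrite mul0r.
Qed.

Lemma smoothD f g : smooth f -> smooth g -> smooth (fun x => f x + g x).
Proof.
move=> [fl1 [c cl fo]] [gl [d dl go]]; split; first exact: lipbD.
exists (fun a x => c a x + d a x) => [a|]; first exact: lipbD.
apply: edgeo_ext (edgeoD fo go) => h i x.
under eq_bigr do rewrite mulrDl.
by rewrite big_split/=; ring.
Qed.

(** Beyond the usual product rule there remains the product of the two increments, which is
    O(h^2). *)
Lemma smoothM f g : smooth f -> smooth g -> smooth (fun x => f x * g x).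
Proof.
move=> [fl1 [c cl fo]] [gl1 [d dl go]]; split; first exact: lipbM.
exists (fun a x => f x * d a x + g x * c a x) => [a|].
  by apply: lipbD; exact: lipbM.
have [L fL _] := fl1; have [M gM _] := gl1.
apply: edgeo_ext (edgeoD (edgeoD (edgeoM fL go) (edgeoM gM fo)) (lipb_dif2 fl1 gl1)).
move=> h i x; under eq_bigr do rewrite mulrDl -!mulrA.
by rewrite big_split/= -!mulr_sumr; ring.
Qed.

Lemma smoothZ c f : smooth f -> smooth (fun x => c * f x).
Proof. exact/smoothM/smooth_cst. Qed.

Lemma smooth_ext f g : (forall x, f x = g x) -> smooth f -> smooth g.
Proof. by move=> fg; rewrite (_ : f = g)//; exact/funext. Qed.

Lemma smoothB f g : smooth f -> smooth g -> smooth (fun x => f x - g x).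
Proof.
move=> fs gs; apply: smooth_ext (smoothD fs (smoothZ (-1) gs)) => x.
by rewrite mulN1r.
Qed.

Lemma smooth_sum (J : Type) (s : seq J) (Q : pred J) (f : J -> X -> R) :
  (forall j, smooth (f j)) -> smooth (fun x => \sum_(j <- s | Q j) f j x).
Proof.
move=> fs; elim: s => [|j s IH].
  by apply: smooth_ext (smooth_cst 0) => x; rewrite big_nil.
case: (boolP (Q j)) => Qj.
  by apply: smooth_ext (smoothD (fs j) IH) => x; rewrite big_cons Qj.
by apply: smooth_ext IH => x; rewrite big_cons (negbTE Qj).
Qed.

Definition pos_part (t : R) : R := Num.max 0 t.

Lemma lipb_pos_part f : lipb f -> lipb (fun x => pos_part (f x)).
Proof.
have pL s t : `|pos_part s - pos_part t| <= `|s - t|.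
  rewrite /pos_part /Num.max; case: (ger0P (s - t)) => ?;
    case: (ltP 0 s) => ?; case: (ltP 0 t) => ?; rewrite ler_norml; apply/andP; split; lra.
move=> [L fL dfL]; exists L => [x|h i x h0].
  apply: le_trans (fL x); have := pL (f x) 0.
  by rewrite /pos_part maxxx !subr0.
exact: le_trans (pL _ _) (dfL _ _ _ h0).
Qed.

(* The square of the positive part is a [C^{1,1}] function that vanishes on a
   half-line; plateaux are made out of it. *)
Lemma smooth_pos_part f : smooth f -> smooth (fun x => pos_part (f x) ^+ 2).
Proof.
move=> [fl1 [c cl fo]].
have pl := lipb_pos_part fl1.
split; first by have := lipbM pl pl; under eq_fun do rewrite -expr2.
exists (fun a x => 2 * pos_part (f x) * c a x) => [a|].
  by apply: lipbM => //; exact: lipbZ.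
have [M pM _] := lipbZ 2 pl.
(* The first-order Taylor remainder of the squared positive part; in each of the four sign cases it
   is at most the square of the increment. *)
pose s h i x := pos_part (f (shv h i x)) ^+ 2 - pos_part (f x) ^+ 2 -
  2 * pos_part (f x) * (f (shv h i x) - f x).
have so : edgeo s.
  apply: edgeo_le (lipb_dif2 fl1 fl1) => h i x h0.
  rewrite /s -expr2 [leRHS]ger0_norm ?sqr_ge0//.
  move: (f (shv h i x)) (f x) => a b; rewrite /pos_part /Num.max.
  have a2 := sqr_ge0 a; have b2 := sqr_ge0 b; have ab2 := sqr_ge0 (a - b).
  have abE : (a - b) ^+ 2 = a ^+ 2 - 2 * (a * b) + b ^+ 2 by ring.
  have bb : b * (a - b) = a * b - b ^+ 2 by ring.
  rewrite ler_norml abE; rewrite abE in ab2.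
  case: (ltP 0 a) => a0; case: (ltP 0 b) => b0; rewrite -mulrA ?bb ?mul0r ?expr0n/=.
  - by apply/andP; split; lra.
  - have ab0 : a * b <= 0 by rewrite mulr_ge0_le0// ltW.
    by apply/andP; split; lra.
  - have ab0 : a * b <= 0 by rewrite mulr_le0_ge0// ltW.
    by apply/andP; split; lra.
  - by apply/andP; split; lra.
apply: edgeo_ext (edgeoD (edgeoM pM fo) so) => h i x; rewrite /s.
under eq_bigr do rewrite -!mulrA.
by rewrite -!mulr_sumr; ring.
Qed.

End Edgeo.

(** * Vanishing of long words in the pulled-back differentials *)

Section WordsNull.
Variables (R : realType) (n k : nat).
Local Notation X := 'rV[R]_k.

Lemma contact_words_null (u v : 'I_n -> X -> R) (p : X -> R) :
  (forall j, lipb (u j)) -> (forall j, lipb (v j)) ->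
  edgeo (fun h i x => \sum_j u j x * (v j (shv h i x) - v j x) +
                      (p (shv h i x) - p x)) ->
  forall psi (w : seq ('I_n * bool)), lipb psi -> cpt psi -> (n < size w)%N ->
  nullseq (wint psi (map (fun a : 'I_n * bool => if a.2 then v a.1 else u a.1) w)).
Proof.
move=> ul vl uvp psi w psil psi0 nw.
set F := fun a : 'I_n * bool => _.
have Fl a : lipb (F a) by rewrite /F; case: ifP.
have Fwl (s : seq ('I_n * bool)) : lipb_seq (map F s) by elim: s.
apply: (@long_word_null n (nat -> R) (@nullseq R) _ _ _ _
  (fun w => wint psi (map F w))) => //.
- exact: nullseq0.
- by move=> s t; exact: nullseqD.
- by move=> s; exact: nullseqN.
- move=> s [//|m] _; apply: (@nullseqM _ 1) => N; rewrite mul1r.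
  have -> : (s *+ m.+1) N = s N *+ m.+1.
    by elim: (m.+1) => // q IH; rewrite !mulrS -IH.
  by rewrite normrMn -mulr_natl ler_peMl// ler1n.
- by move=> q a b s; rewrite !map_cat /=; exact: wint_anticomm.
- move=> q s; have := @wint_contact R k psi (map F q) (map F s) _ u v p
    psil psi0 (Fwl q) (Fwl s) uvp.
  apply: nullseq_ext => N; rewrite fct_sumE.
  by apply: eq_bigr => j _; rewrite map_cat.
Qed.

End WordsNull.

Local Open Scope classical_set_scope.
Local Open Scope ring_scope.

(** * Horizontal curves *)

Section AbsContinuous.
Variable R : realType.
Local Notation mu := (@lebesgue_measure R).

(** At the supremum of the points where [P] holds, the left clause yields [P]; below [b], the right
    clause would then pass beyond the supremum. *)
Lemma real_induction (a b : R) (P : R -> Prop) : a <= b -> P a ->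
  (forall c, a <= c <= b -> exists2 eta, 0 < eta &
    forall s, a <= s <= b -> `|s - c| < eta ->
      (s < c -> P s -> P c) /\ (c < s -> P c -> P s)) -> P b.
Proof.
move=> ab Pa loc.
pose S := [set s | a <= s <= b /\ P s].
have Sa : S a by rewrite /S /= lexx ab.
have supS : has_sup S.
  by split; [exists a|exists b => s [/andP[]]].
have leS : forall s, S s -> s <= sup S by exact: sup_upper_bound.
have ac : a <= sup S by exact: leS.
have cb : sup S <= b by apply: ge_sup; [exists a|move=> s [/andP[]]].
have [eta eta0 locc] := loc (sup S) (introT andP (conj ac cb)).
have [s Ss cs] := sup_adherent eta0 supS.
have sc := leS _ Ss; case: Ss => sab Ps.
have Pc : P (sup S).
  move: sc; rewrite le_eqVlt => /orP[/eqP<-//|sc].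
  apply: (locc s sab _).1 => //.
  by rewrite distrC ger0_norm ?subr_ge0 1?ltW// ltrBlDr -ltrBlDl.
move: cb; rewrite le_eqVlt => /orP[/eqP<-//|cb].
pose t := Num.min b (sup S + eta / 2).
have ct : sup S < t by rewrite lt_min cb ltrDl divr_gt0.
have tab : a <= t <= b by rewrite (le_trans ac (ltW ct)) ge_min lexx.
have Pt : P t.
  apply: (locc t tab _).2 => //.
  rewrite ger0_norm ?subr_ge0 1?ltW//.
  have : t <= sup S + eta / 2 by rewrite ge_min lexx orbT.
  by move: (sup S) => c ?; lra.
have /leS : S t by [].
by rewrite leNgt ct.
Qed.

Lemma derivable_slope (f : R -> R) c e : derivable f c 1 -> 0 <= derive1 f c ->
  0 < e -> exists2 eta, 0 < eta & forall s, `|s - c| < eta ->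
    (s < c -> - e * (c - s) <= f c - f s) /\
    (c < s -> - e * (s - c) <= f s - f c).
Proof.
move=> df f'0 e0.
have : h^-1 *: (f (h *: 1 + c) - f c) @[h --> 0^'] --> derive1 f c.
  by rewrite derive1E; exact: df.
move=> /cvgrPdist_lt /(_ _ e0) [eta /= eta0 fe].
exists eta => // s sc.
have key : s != c -> - e < (s - c)^-1 * (f s - f c).
  move=> snc; have := fe (s - c); rewrite /= sub0r normrN => /(_ sc).
  rewrite subr_eq0 => /(_ snc).
  rewrite /= [X in f X](_ : _ = s); last by rewrite scaler1 subrK.
  rewrite ltr_norml => /andP[_].
  rewrite -[_ *: _]/((s - c)^-1 * (f s - f c)) => ?.
  by lra.
split=> [sc'|cs].
  have := key (negbT (lt_eqF sc')).
  rewrite -(opprB c s) invrN mulNr ltrN2 ltr_pdivrMl ?subr_gt0// => ?.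
  by lra.
have := key (negbT (gt_eqF cs)).
rewrite ltr_pdivlMl ?subr_gt0// => /ltW.
by rewrite mulrC.
Qed.

Definition ac_fun (a b : R) (u : R -> R) := forall e, 0 < e ->
  exists2 d : R, 0 < d & forall (N : nat) (x y : 'I_N -> R),
      (forall i, [/\ a <= x i, x i < y i & y i <= b]) ->
      trivIset setT (fun i => `]x i, y i[%classic) ->
      \sum_(i < N) (y i - x i) < d ->
      \sum_(i < N) `|u (x i) - u (y i)| < e.

Lemma open_cover_null (Z : set R) d : mu.-negligible Z -> 0 < d ->
  exists O : set R, [/\ open O, Z `<=` O & (mu O < d%:E)%E].
Proof.
move=> [A [mA A0 ZA]] d0.
have [|O [oO AO OAd]] := lebesgue_regularity_outer mA _ d0.
  by rewrite [X in (X < _)%E]A0.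
exists O; split => //; first exact: subset_trans AO.
have <- : (O `\` A) `|` A = O by rewrite setUC setDUK.
apply: (le_lt_trans _ OAd).
have mO : measurable O by exact: open_measurable.
apply: le_trans (measureU2 _ _ _) _ => //; first exact: measurableD.
by rewrite [X in (_ + X)%E]A0 adde0.
Qed.

Lemma sum_intervals_lt (O : set R) d (l : seq (R * R)) :
  open O -> (mu O < d%:E)%E ->
  (forall p, p \in l -> p.1 < p.2 /\ `[p.1, p.2] `<=` O) ->
  trivIset setT (fun i : 'I_(size l) => `](nth (0, 0) l i).1, (nth (0, 0) l i).2[%classic) ->
  \sum_(i < size l) ((nth (0, 0) l i).2 - (nth (0, 0) l i).1) < d.
Proof.
move=> oO Od lO tl; rewrite -lte_fin; apply: le_lt_trans Od.
pose F (i : 'I_(size l)) := `](nth (0, 0) l i).1, (nth (0, 0) l i).2[%classic : set R.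
rewrite -sumEFin (_ : (\sum_(i < _) _)%E = mu (\big[setU/set0]_(i < size l) F i)); last first.
  rewrite (@measure_bigsetU_ord _ _ _ mu _ xpredT)//; last first.
    by move=> i; exact: measurable_itv.
  apply: eq_bigr => i _; rewrite /F [RHS]lebesgue_measure_itv/= lte_fin.
  by rewrite (lO _ (mem_nth _ (ltn_ord i))).1 EFinB.
apply: le_measure; rewrite ?inE.
- by apply: bigsetU_measurable => i _; exact: measurable_itv.
- exact: open_measurable.
- apply: (big_ind (fun A => A `<=` O)) => [|A B AO BO|i _].
  + exact: sub0set.
  + by rewrite subUset.
  + apply: subset_trans (lO _ (mem_nth (0, 0) (ltn_ord i))).2.
    exact: subset_itv_oo_cc.
Qed.

(* The exceptional set is covered by an open set W of small measure. The interval
   is cut into pieces on which the slope of U - u is at least - e, and pieces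
   inside W, on which the total variation of u is small. *)
Lemma ac_le_nondecreasing (a b : R) (u U : R -> R) (Z : set R) : a <= b ->
  ac_fun a b u -> {in `[a, b] &, {homo U : x y / x <= y}} ->
  mu.-negligible Z ->
  (forall s, a <= s <= b -> ~ Z s ->
     [/\ derivable u s 1, derivable U s 1 & derive1 u s <= derive1 U s]) ->
  u b - u a <= U b - U a.
Proof.
move=> ab acu ndU Z0 duU.
suff key e : 0 < e -> u b - u a <= U b - U a + e * (b - a) + e.
  apply/ler_addgt0Pr => e e0.
  have c0 : 0 < b - a + 1 by rewrite ltr_wpDl// subr_ge0.
  have := key (e / (b - a + 1)) (divr_gt0 e0 c0).
  rewrite -addrA (_ : e / (b - a + 1) * (b - a) + e / (b - a + 1) = e)//.
  by field; rewrite gt_eqF.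
move=> e0; have [d d0 ud] := acu e e0.
have [W [oW ZW Wd]] := @open_cover_null Z d Z0 d0.
pose w s := U s - u s.
(* [l] lists the pieces inside [W] met so far, the latest first. There, [U] being monotone, [w]
   drops by at most the variation of [u], whose total absolute continuity keeps below [e]. *)
pose good s := exists l : seq (R * R),
  [/\ forall p, p \in l -> [/\ a <= p.1, p.1 < p.2, p.2 <= s & `[p.1, p.2] `<=` W],
      pairwise (fun p q : R * R => q.2 <= p.1) l &
      - e * (s - a) - \sum_(p <- l) `|u p.1 - u p.2| <= w s - w a].
have good_w s t : s <= t -> - e * (t - s) <= w t - w s -> good s -> good t.
  move=> st wst [l [lO lp lw]]; exists l; split => //.
    by move=> p /lO[? ? ? ?]; split => //; exact: le_trans st.
  by lra.
have good_O s t : a <= s -> t <= b -> s < t -> `[s, t] `<=` W -> good s -> good t.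
  move=> as_ tb st stO [l [lO lp lw]]; exists ((s, t) :: l); split.
  - move=> p; rewrite inE => /predU1P[->//|/lO[? ? ? ?]]; split => //.
    exact: le_trans (ltW st).
  - by rewrite pairwise_cons lp andbT; apply/allP => p /lO[].
  - rewrite big_cons /=.
    have : U s <= U t.
      by apply: ndU; rewrite ?in_itv/= ?as_ ?tb ?(ltW st) ?andbT//=;
        [exact: le_trans (ltW st) tb|exact: le_trans as_ (ltW st)].
    have := ler_norm (u t - u s); rewrite distrC.
    have : 0 <= e * (t - s) by rewrite mulr_ge0 ?subr_ge0 ?ltW.
    rewrite /w in lw *; lra.
have [l [lO lp lw]] : good b.
  apply: (@real_induction a b) => //.
    by exists [::]; split => //; rewrite big_nil !subrr mulr0 subr0.
  move=> c cab; have [Wc|nWc] := pselect (W c).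
    have [eta /= eta0 etaW] : nbhs c W by exact: open_nbhs_nbhs.
    exists eta => // s sab sc.
    case/andP: cab => ac cb; case/andP: sab => as_ sb.
    move: sc; rewrite ltr_distlC => /andP[sc1 sc2].
    split=> sc; apply: good_O => // x; rewrite /= in_itv/= => /andP[x1 x2];
      by apply: etaW; rewrite /= ltr_distlC; apply/andP; split; lra.
  have [du dU duU'] := duU c cab (fun h => nWc (ZW _ h)).
  have dw : derivable w c 1 by exact: derivableB.
  have w'0 : 0 <= derive1 w c.
    by rewrite derive1E deriveB// -!derive1E subr_ge0.
  have [eta eta0 weta] := derivable_slope dw w'0 e0.
  exists eta => // s sab /weta[ws1 ws2]; split => sc.
    by apply: good_w; [exact: ltW|exact: ws1].
  by apply: good_w; [exact: ltW|exact: ws2].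
have tl : trivIset setT
    (fun i : 'I_(size l) => `](nth (0, 0) l i).1, (nth (0, 0) l i).2[%classic).
  apply/trivIsetP => i j _ _.
  have main (i' j' : 'I_(size l)) : (i' < j')%N ->
      `](nth (0, 0) l i').1, (nth (0, 0) l i').2[ `&`
      `](nth (0, 0) l j').1, (nth (0, 0) l j').2[%classic = set0.
    move=> ij; rewrite -subset0 => x [] /=; rewrite !in_itv/=.
    move=> /andP[x1 _] /andP[_ x2].
    have := (pairwiseP (0, 0) lp) i' j' (ltn_ord i') (ltn_ord j') ij.
    by rewrite leNgt (lt_trans x1 x2).
  rewrite neq_ltn => /orP[|] ij; first exact: main.
  by rewrite setIC; exact: main.
have := ud _ (fun i : 'I_(size l) => (nth (0, 0) l i).1)
   (fun i : 'I_(size l) => (nth (0, 0) l i).2) _ tl _.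
rewrite -(big_mkord xpredT (fun i => `|u (nth (0, 0) l i).1 - u (nth (0, 0) l i).2|)).
rewrite -(big_nth (0, 0) xpredT (fun p => `|u p.1 - u p.2|)) => /(_ _ _)/wrap[].
- by move=> i; have [? ? ? _] := lO _ (mem_nth (0, 0) (ltn_ord i)).
- apply: (sum_intervals_lt oW Wd _ tl) => p /lO[_ ? _ ?]; by split.
- by rewrite /w in lw; lra.
Qed.

End AbsContinuous.

(** * Arc length as a monotone primitive *)

Section Contact.
Variable R : realType.
Local Notation mu := (@lebesgue_measure R).

Lemma ae_derivable_primitive (v : R -> R) : (forall s, 0 <= v s) ->
  mu.-integrable setT (EFin \o v) ->
  exists U : R -> R, [/\ {homo U : x y / x <= y},
    forall x y, ((U y - U x)%:E <= \int[mu]_s (v s)%:E)%E &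
    {ae mu, forall s, derivable U s 1 /\ derive1 U s = v s}].
Proof.
move=> v0 intv.
have intvy y : mu.-integrable `]-oo, y] (EFin \o v).
  by apply: integrableS intv.
have loc : locally_integrable setT v.
  by have := integrable_locally measurableT intv; rewrite patch_setT.
have mv : measurable_fun setT (EFin \o v) by case/integrableP: intv.
pose U y := \int[mu]_(t in `]-oo, y]) v t.
have fU y : ((U y)%:E = \int[mu]_(t in `]-oo, y]) (v t)%:E)%E.
  rewrite /U /Rintegral fineK//.
  by apply: integrable_fin_num.
have U0 y : 0 <= U y by apply: Rintegral_ge0.
exists U; split.
- move=> x y xy; rewrite -lee_fin !fU; apply: ge0_subset_integral => //.
  + by apply: measurable_funS mv.
  + by move=> s _; rewrite lee_fin.
  + by apply: subset_itvl; rewrite bnd_simp.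
- move=> x y; apply: (@le_trans _ _ (U y)%:E).
    by rewrite lee_fin lerBlDr lerDl.
  by rewrite fU; apply: ge0_subset_integral => // s _; rewrite lee_fin.
- exact: FTC1Ny intvy loc.
Qed.

(* [v] need not be measurable: the integral is a supremum over simple functions. *)
Lemma le_integral_patch (D E : set R) (v : R -> R) : D `<=` E ->
  (forall s, 0 <= v s) ->
  (\int[mu]_s ((v \_ D) s)%:E <= \int[mu]_(s in E) (v s)%:E)%E.
Proof.
move=> DE v0.
have vD s : 0 <= (v \_ D) s by rewrite /patch; case: ifP.
rewrite !ge0_integralE => [|s _|s _]; rewrite ?lee_fin//.
apply: le_ereal_sup => _ [h /= hv <-]; exists h => // s.
apply: le_trans (hv s) _; rewrite /patch in_setT.
case: ifPn => sD; first by rewrite ifT// inE; apply: DE; rewrite inE in sD.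
by case: ifP => _; rewrite ?lee_fin.
Qed.

(** The derivative is a limit of difference quotients of the extension of [g] by 0; at a point of
    the open interval these eventually involve only values of [g]. *)
Lemma measurable_derive1 (g : R -> R) (a b : R) (D : set R) :
  {within `[a, b], continuous g} -> measurable D -> D `<=` `]a, b[ ->
  (forall s, D s -> derivable g s 1) -> measurable_fun D (derive1 g).
Proof.
move=> cg mD Dab dg.
pose G := g \_ `[a, b].
have mG : measurable_fun setT G.
  apply/(measurable_restrictT _ _).1 => //.
  exact: subspace_continuous_measurable_fun.
pose q n s : R := n.+1%:R * (G (s + n.+1%:R^-1) - G s).
apply: (@measurable_fun_cvg _ _ _ D q).
  move=> m; apply: (@measurable_funS _ _ _ _ setT) => //.
  apply: measurable_funM => //; apply: measurable_funB => //.
  apply: (@measurableT_comp _ _ _ _ _ _ G) => //.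
  exact: measurable_funD.
move=> s Ds; apply/cvgrPdist_lt => e e0.
have : h^-1 *: (g (h *: 1 + s) - g s) @[h --> 0^'] --> derive1 g s.
  by rewrite derive1E; exact: dg.
move=> /cvgrPdist_lt /(_ _ e0) [eta /= eta0 ge].
have := Dab _ Ds; rewrite /= in_itv/= => /andP[as_ sb].
have bs0 : 0 < b - s by rewrite subr_gt0.
near=> m.
have m0 : 0 < m.+1%:R^-1 :> R by rewrite invr_gt0.
have mb : m.+1%:R^-1 < b - s.
  by near: m; exact: (near_infty_natSinv_lt (PosNum bs0)).
have meta : m.+1%:R^-1 < eta.
  by near: m; exact: (near_infty_natSinv_lt (PosNum eta0)).
have := ge m.+1%:R^-1; rewrite /= sub0r normrN gtr0_norm// => /(_ meta).
rewrite gt_eqF// => /(_ isT); rewrite invrK scaler1.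
rewrite /q /G !patchE !mem_set//=.
- by rewrite [s + _]addrC.
- by rewrite in_itv/= !ltW.
- by rewrite in_itv/=; move: m0 mb; move: (m.+1%:R^-1) => t t0 tb; lra.
Unshelve. all: by end_near. Qed.

Lemma ac_fun_continuous (a b : R) (u : R -> R) :
  ac_fun a b u -> {within `[a, b], continuous u}.
Proof.
move=> acu; apply/subspace_continuousP => x xab; apply/cvgrPdist_lt => e e0.
have [d d0 ud] := acu e e0.
have main s t : a <= s -> s < t -> t <= b -> t - s < d -> `|u s - u t| < e.
  move=> as_ st tb std.
  have := ud 1%N (fun=> s) (fun=> t); rewrite !big_ord_recl !big_ord0 !addr0.
  apply => //; apply/trivIsetP => i j _ _.
  by rewrite (ord1 i) (ord1 j) eqxx.
move: xab; rewrite /= in_itv/= => /andP[ax xb].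
rewrite near_withinE; exists d => //= y yd.
rewrite in_itv/= => /andP[ay yb].
have := yd; rewrite /= ltr_distl => /andP[? ?].
case: (ltgtP x y) => [xy|xy|->]; last by rewrite subrr normr0.
  by apply: main => //; lra.
by rewrite distrC; apply: main => //; lra.
Qed.

Lemma ler_eucl_norm m (v : 'rV[R]_m) i : `|v 0 i| <= eucl_norm v.
Proof.
rewrite /eucl_norm -sqrtr_sqr ler_wsqrtr// (bigD1 i)//= lerDl.
by apply: sumr_ge0 => j _; exact: sqr_ge0.
Qed.

Lemma ac_fun_linear m (a b : R) (gamma : R -> 'rV[R]_m) (c : 'I_m -> R) :
  abs_continuous a b gamma -> ac_fun a b (fun s => \sum_i c i * gamma s 0 i).
Proof.
move=> acg e e0; pose C := \sum_i `|c i|.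
have C0 : 0 <= C by apply: sumr_ge0.
have C1 : 0 < C + 1 by rewrite ltr_wpDl.
have [d d0 gd] := acg _ (divr_gt0 e0 C1).
exists d => // N x y xy txy sxy; have := gd N x y xy txy sxy.
rewrite ltr_pdivlMr// mulrC => /(le_lt_trans _); apply.
rewrite mulr_sumr; apply: ler_sum => j _.
rewrite -sumrB; apply: (@le_trans _ _ (C * eucl_dist (gamma (x j)) (gamma (y j)))).
  rewrite /C mulr_suml (le_trans (ler_norm_sum _ _ _))//.
  apply: ler_sum => i _; rewrite -mulrBr normrM ler_wpM2l//.
  by have := ler_eucl_norm (gamma (x j) - gamma (y j)) i; rewrite !mxE.
by rewrite ler_wpM2r ?sqrtr_ge0// lerDl.
Qed.

Lemma derive1_coord m (gamma : R -> 'rV[R]_m) s i : derivable gamma s 1 ->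
  derivable (fun t => gamma t 0 i) s 1 /\
  derive1 (fun t => gamma t 0 i) s = derive1 gamma s 0 i.
Proof.
move=> dg; split; first exact: (derivable_mxP _ _ _).1.
by rewrite !derive1E derive_mx// mxE.
Qed.

Lemma derive1_linear m (gamma : R -> 'rV[R]_m) (c : 'I_m -> R) s :
  derivable gamma s 1 ->
  derivable (fun t => \sum_i c i * gamma t 0 i) s 1 /\
  derive1 (fun t => \sum_i c i * gamma t 0 i) s = \sum_i c i * derive1 gamma s 0 i.
Proof.
move=> dg.
have H i : is_derive s 1 (c i \*: (fun t => gamma t 0 i)) (c i * derive1 gamma s 0 i).
  have [di Di] := derive1_coord i dg.
  by apply: DeriveDef; [exact: derivableZ|rewrite deriveZ// -derive1E Di].
have := @is_derive_sum R R R m (fun i => c i \*: (fun t => gamma t 0 i)) s 1 _ H.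
rewrite (_ : \sum_(i < m) _ = fun t => \sum_i c i * gamma t 0 i); last first.
  by apply/funext => t; rewrite fct_sumE.
by move=> [? ?]; rewrite derive1E.
Qed.

(** [U] is arc length. Measurability of the speed is established only on [D], where [hnormE]
    expresses it by coordinates of the derivative; the rest of the interval is null and goes into
    [Z]. *)
Lemma horizontal_primitive n (a b : R) (gamma : R -> heis R n) r : a < b ->
  horizontal a b gamma -> (hlength a b gamma < r%:E)%E ->
  exists U : R -> R, [/\ {homo U : x y / x <= y}, forall x y, U y - U x <= r &
    exists2 Z : set R, mu.-negligible Z & forall s, a <= s <= b -> ~ Z s ->
      [/\ derivable gamma s 1, derive1 gamma s \in hspace (gamma s),
          derivable U s 1 & derive1 U s = hnorm (gamma s) (derive1 gamma s)]].
Proof.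
move=> ab [acg [A [mA A0 hA]]] lr.
have hor s : a <= s <= b -> ~ A s ->
    derivable gamma s 1 /\ derive1 gamma s \in hspace (gamma s).
  move=> sab nAs; apply: contrapT => h; apply: nAs; apply: hA => /= /(_ _) h'.
  by apply: h; apply: h'; rewrite in_itv.
pose D := `]a, b[ `\` A : set R.
have mD : measurable D by exact: measurableD.
have Dab s : D s -> a < s < b by move=> [/= + _]; rewrite in_itv.
have horD s : D s -> derivable gamma s 1 /\ derive1 gamma s \in hspace (gamma s).
  by move=> Ds; have /andP[? ?] := Dab _ Ds; apply: hor Ds.2; rewrite !ltW.
pose v s := hnorm (gamma s) (derive1 gamma s).
have v0 s : 0 <= v s by exact: sqrtr_ge0.
have vD0 s : 0 <= (v \_ D) s by rewrite /patch; case: ifP.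
have mcoord i : measurable_fun D (fun s => derive1 gamma s 0 i).
  have mi : measurable_fun D (derive1 (fun t => gamma t 0 i)).
    apply: (@measurable_derive1 _ a b) => //.
    - apply: ac_fun_continuous.
      have := @ac_fun_linear _ a b gamma (fun j => (j == i)%:R) acg.
      rewrite (_ : (fun s => _) = fun t => gamma t 0 i)//; apply/funext => t.
      rewrite (bigD1 i)//= eqxx mul1r big1 ?addr0// => j ji.
      by rewrite (negbTE ji) mul0r.
    - by move=> s /horD[dg _]; case: (derive1_coord i dg).
  apply: eq_measurable_fun mi => s; rewrite inE => /horD[dg _].
  by case: (derive1_coord i dg).
have mv : measurable_fun D v.
  pose v' s := Num.sqrt (\sum_(j < n) (derive1 gamma s 0 (xidx j) ^+ 2 +
    derive1 gamma s 0 (yidx j) ^+ 2)).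
  apply: (@eq_measurable_fun _ _ _ _ _ v').
    by move=> s; rewrite inE => /horD[_ dg]; rewrite /v hnormE.
  apply: (@measurableT_comp _ _ _ _ _ _ (@Num.sqrt R)).
    by apply: continuous_measurable_fun; exact: sqrt_continuous.
  apply: measurable_sum => j.
  by apply: measurable_funD; exact: measurable_funX.
have lev : (\int[mu]_s ((v \_ D) s)%:E < r%:E)%E.
  apply: le_lt_trans lr; apply: le_integral_patch => //.
  by move=> s /Dab /andP[? ?]; rewrite /= in_itv/= !ltW.
have [|U [ndU Ur [B [mB B0 hB]]]] := @ae_derivable_primitive (v \_ D) vD0.
  apply/integrableP; split.
    by apply/measurable_EFinP; apply/(measurable_restrictT _ _).1.
  under eq_integral do rewrite /= ger0_norm//.
  by apply: lt_trans lev _; rewrite ltry.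
exists U; split => // [x y|].
  by rewrite -lee_fin (le_trans (Ur x y))// ltW.
exists (A `|` B `|` [set a] `|` [set b]).
  have null_set1 c : mu.-negligible [set c].
    by exists [set c]; split => //; exact: lebesgue_measure_set1.
  do 2 (apply: negligibleU; last exact: null_set1).
  apply: negligibleU; [exists A; split; [exact: mA|exact: A0|exact: subset_refl]
                     |exists B; split; [exact: mB|exact: B0|exact: subset_refl]].
move=> s sab nZ.
have nAs : ~ A s by move=> ?; apply: nZ; left; left; left.
have nBs : ~ B s by move=> ?; apply: nZ; left; left; right.
have [dg hg] := hor s sab nAs.
have Ds : D s.
  split => //=; rewrite in_itv/= !lt_neqAle; case/andP: sab => -> ->.
  by rewrite !andbT; apply/andP; split; apply/eqP => sE; apply: nZ;
    [left; right|right]; rewrite /= sE.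
have [dU DU] : derivable U s 1 /\ derive1 U s = (v \_ D) s.
  by apply: contrapT => h; apply: nBs; exact: hB.
by split => //; rewrite DU patchE mem_set.
Qed.

Lemma ac_fun_sub (a b b' : R) u : b' <= b -> ac_fun a b u -> ac_fun a b' u.
Proof.
move=> bb acu e e0; have [d d0 ud] := acu e e0; exists d => // N x y xy.
by apply: ud => i; have [? ? yb] := xy i; split => //; exact: le_trans bb.
Qed.

Lemma ac_norm_le (a b : R) (u U : R -> R) (K r : R) (Z : set R) : a <= b ->
  0 <= K -> ac_fun a b u -> {homo U : x y / x <= y} ->
  (forall x y, U y - U x <= r) -> mu.-negligible Z ->
  (forall s, a <= s <= b -> ~ Z s ->
     [/\ derivable u s 1, derivable U s 1 & `|derive1 u s| <= K * derive1 U s]) ->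
  `|u b - u a| <= K * r.
Proof.
move=> ab K0 acu ndU Ur Z0 duU.
have ndKU : {in `[a, b] &, {homo (fun s => K * U s) : x y / x <= y}}.
  by move=> x y _ _ xy; rewrite ler_wpM2l// ndU.
have dKU s : derivable U s 1 -> derivable (fun t => K * U t) s 1 /\
    derive1 (fun t => K * U t) s = K * derive1 U s.
  move=> dU; split; first exact: derivableZ.
  by rewrite !derive1E; exact: deriveZ.
have KUr : K * U b - K * U a <= K * r by rewrite -mulrBr ler_wpM2l.
rewrite ler_norml; apply/andP; split; last first.
  apply: le_trans KUr; apply: (ac_le_nondecreasing ab acu ndKU Z0) => s sab nZ.
  have [du dU le_uU] := duU s sab nZ; have [? ->] := dKU s dU.
  by split => //; apply: le_trans le_uU; exact: ler_norm.
have acNu : ac_fun a b (fun s => - u s).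
  move=> e e0; have [d d0 ud] := acu e e0; exists d => // N x y xy t sxy.
  have := ud N x y xy t sxy; rewrite (eq_bigr (fun i => `|- u (x i) - - u (y i)|))//.
  by move=> i _; rewrite -opprD normrN.
suff : - u b - - u a <= K * r by move=> h; rewrite lerNl; lra.
apply: le_trans KUr; apply: (ac_le_nondecreasing ab acNu ndKU Z0) => s sab nZ.
have [du dU le_uU] := duU s sab nZ; have [? ->] := dKU s dU.
split => //; first exact: derivableN.
rewrite derive1E deriveN// -derive1E.
by apply: le_trans le_uU; rewrite -normrN ler_norm.
Qed.

End Contact.

(** * The contact form on the chord of a horizontal curve *)

Section Contact.
Variable R : realType.
Local Notation mu := (@lebesgue_measure R).

Lemma hspace_tidx n (p v : heis R n) : v \in hspace p ->
  v 0 (tidx n) = \sum_(j < n) (2 * p 0 (yidx j) * v 0 (xidx j) -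
                               2 * p 0 (xidx j) * v 0 (yidx j)).
Proof.
move=> vp; rewrite (coord_span vp).
under [RHS]eq_bigr do rewrite hcomb_xidx hcomb_yidx.
rewrite summxE big_split_ord /= sumrB; congr (_ + _).
  apply: eq_bigr => j _; rewrite hframe_lshift !mxE eqxx /=.
  by rewrite [tidx n == xidx j]eq_sym xidx_neq_tidx eqxx /= add0r mulr1 mulrC.
rewrite -sumrN; apply: eq_bigr => j _; rewrite hframe_rshift !mxE eqxx /=.
by rewrite [tidx n == yidx j]eq_sym yidx_neq_tidx eqxx /= sub0r mulr1 mulrN mulrC.
Qed.

Lemma hnorm_xidx n (p v : heis R n) j : v \in hspace p ->
  `|v 0 (xidx j)| <= hnorm p v /\ `|v 0 (yidx j)| <= hnorm p v.
Proof.
move=> vp; rewrite hnormE//.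
have S0 : forall i, i != j ->
    0 <= v 0 (xidx i) ^+ 2 + v 0 (yidx i) ^+ 2 by move=> i _; rewrite addr_ge0 ?sqr_ge0.
rewrite (bigD1 j)//=.
split; rewrite -sqrtr_sqr ler_wsqrtr//.
  by rewrite -addrA lerDl addr_ge0 ?sqr_ge0 ?sumr_ge0.
by rewrite addrAC lerDr addr_ge0 ?sqr_ge0 ?sumr_ge0.
Qed.

(* The contact form at [p] applied to [q - p]. *)
Definition contact_defect n (p q : heis R n) : R :=
  q 0 (tidx n) - p 0 (tidx n) -
  \sum_(j < n) (2 * p 0 (yidx j) * (q 0 (xidx j) - p 0 (xidx j)) -
                2 * p 0 (xidx j) * (q 0 (yidx j) - p 0 (yidx j))).

Lemma delta_linear m (i : 'I_m) (v : 'rV[R]_m) :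
  \sum_l (l == i)%:R * v 0 l = v 0 i.
Proof.
rewrite (bigD1 i)//= eqxx mul1r big1 ?addr0// => l li.
by rewrite (negbTE li) mul0r.
Qed.

(** The contact form is frozen at the starting point. The form at the current point kills the
    velocity, and the coefficients of the two differ by at most 2 r because coordinates move by at
    most the length; integrating the speed gives the second factor [r]. *)
Lemma hlength_contact n (a b : R) (gamma : R -> heis R n) r : a < b ->
  horizontal a b gamma -> (hlength a b gamma < r%:E)%E ->
  `|contact_defect (gamma a) (gamma b)| <= n%:R * 4 * r * r.
Proof.
move=> ab hg lr; have acg := hg.1.
have [U [ndU Ur [Z Z0 hU]]] := horizontal_primitive ab hg lr.
have r0 : 0 <= r by have := Ur a a; rewrite subrr.
have coord_le s i : a <= s <= b ->
    (forall t, a <= t <= b -> ~ Z t ->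
       `|derive1 gamma t 0 i| <= hnorm (gamma t) (derive1 gamma t)) ->
    `|gamma s 0 i - gamma a 0 i| <= r.
  move=> /andP[as_ sb] hi; rewrite -[leRHS]mul1r.
  have := @ac_norm_le R a s (fun t => gamma t 0 i) U 1 r Z as_ ler01.
  apply => //.
    apply: ac_fun_sub sb _.
    have := ac_fun_linear (fun l => (l == i)%:R) acg.
    rewrite (_ : (fun s => _) = fun t => gamma t 0 i)//; apply/funext => t.
    exact: delta_linear.
  move=> t /andP[at_ ts] nZ.
  have tab : a <= t <= b by rewrite at_ (le_trans ts sb).
  have [dg _ dU DU] := hU t tab nZ.
  by have [? ->] := derive1_coord i dg; split => //; rewrite mul1r DU; exact: hi.
have xle s j : a <= s <= b -> `|gamma s 0 (xidx j) - gamma a 0 (xidx j)| <= r.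
  move=> sab; apply: coord_le => // t tab nZ; have [_ dg _ _] := hU t tab nZ.
  exact: (hnorm_xidx j dg).1.
have yle s j : a <= s <= b -> `|gamma s 0 (yidx j) - gamma a 0 (yidx j)| <= r.
  move=> sab; apply: coord_le => // t tab nZ; have [_ dg _ _] := hU t tab nZ.
  exact: (hnorm_xidx j dg).2.
pose c (l : 'I_(n.*2.+1)) : R := (l == tidx n)%:R - \sum_(j < n)
   (2 * gamma a 0 (yidx j) * (l == xidx j)%:R - 2 * gamma a 0 (xidx j) * (l == yidx j)%:R).
have cE (v : heis R n) : \sum_l c l * v 0 l = v 0 (tidx n) - \sum_(j < n)
   (2 * gamma a 0 (yidx j) * v 0 (xidx j) - 2 * gamma a 0 (xidx j) * v 0 (yidx j)).
  under eq_bigr do rewrite mulrBl mulr_suml.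
  rewrite sumrB delta_linear exchange_big /=; congr (_ - _).
  apply: eq_bigr => j _; under eq_bigr do rewrite mulrBl -!mulrA.
  by rewrite sumrB -!mulr_sumr !delta_linear !mulrA.
have -> : contact_defect (gamma a) (gamma b) =
   \sum_l c l * gamma b 0 l - \sum_l c l * gamma a 0 l.
  rewrite !cE /contact_defect [X in _ - _ - X](_ : _ = \sum_(j < n)
      (2 * gamma a 0 (yidx j) * gamma b 0 (xidx j) -
       2 * gamma a 0 (xidx j) * gamma b 0 (yidx j)) - \sum_(j < n)
      (2 * gamma a 0 (yidx j) * gamma a 0 (xidx j) -
       2 * gamma a 0 (xidx j) * gamma a 0 (yidx j))); first by ring.
  by rewrite -sumrB; apply: eq_bigr => j _; ring.
have K0 : 0 <= n%:R * 4 * r by rewrite !mulr_ge0.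
apply: (@ac_norm_le R a b (fun t => \sum_l c l * gamma t 0 l) U _ r Z (ltW ab) K0) => //.
  exact: ac_fun_linear.
move=> s sab nZ; have [dg hs dU DU] := hU s sab nZ.
have [? ->] := derive1_linear c dg; split => //.
rewrite cE (hspace_tidx hs) -sumrB DU.
apply: le_trans (ler_norm_sum _ _ _) _.
set h := hnorm _ _.
apply: (@le_trans _ _ (\sum_(j < n) 4 * r * h)); last first.
  by rewrite sumr_const card_ord -[leLHS]mulr_natl !mulrA.
apply: ler_sum => j _.
have [xh yh] := hnorm_xidx j hs; rewrite -/h in xh yh.
have := xle s j sab; have := yle s j sab.
set dx := derive1 gamma s 0 (xidx j); set dy := derive1 gamma s 0 (yidx j).
rewrite -/dx -/dy in xh yh.
set X := gamma s 0 (xidx j); set Y := gamma s 0 (yidx j).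
set X' := gamma a 0 (xidx j); set Y' := gamma a 0 (yidx j) => Yr Xr.
have -> : 2 * Y * dx - 2 * X * dy - (2 * Y' * dx - 2 * X' * dy) =
   2 * ((Y - Y') * dx) - 2 * ((X - X') * dy) by ring.
apply: le_trans (ler_normB _ _) _.
have h1 : `|(Y - Y') * dx| <= r * h by rewrite normrM ler_pM.
have h2 : `|(X - X') * dy| <= r * h by rewrite normrM ler_pM.
rewrite (normrM 2 ((Y - _) * _)) (normrM 2 ((X - _) * _)) (@ger0_norm _ 2)//.
by lra.
Qed.

Lemma dcc_contact n (p q : heis R n) r : (dcc p q < r%:E)%E ->
  `|contact_defect p q| <= n%:R * 4 * r * r.
Proof.
move=> /ereal_inf_lt[_ [a [b [gamma [ab hg <- <- ->]]]] lr].
exact: hlength_contact lr.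
Qed.

Lemma dcc_contact_le n (p q : heis R n) r : 0 <= r -> (dcc p q <= r%:E)%E ->
  `|contact_defect p q| <= n%:R * 4 * r * r.
Proof.
move=> r0 pqr; apply/ler_addgt0Pr => e e0.
pose K : R := n%:R * 4; have K0 : 0 <= K by rewrite mulr_ge0.
(* For d <= 1, K (r + d)^2 exceeds K r^2 by at most d K (2 r + 1); the added 1 keeps the denominator
   positive. *)
pose d := Num.min 1 (e / (K * (2 * r + 1) + 1)).
have D0 : 0 < K * (2 * r + 1) + 1 by rewrite ltr_wpDl// mulr_ge0 ?addr_ge0 ?mulr_ge0.
have d0 : 0 < d by rewrite lt_min ltr01 divr_gt0.
have d1 : d <= 1 by rewrite ge_min lexx.
have de : d * (K * (2 * r + 1) + 1) <= e.
  by rewrite -ler_pdivlMr// ge_min lexx orbT.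
have /dcc_contact : (dcc p q < (r + d)%:E)%E.
  by apply: le_lt_trans pqr _; rewrite lte_fin ltrDl.
rewrite -/K => h; apply: (le_trans h).
have : K * (d * d) <= K * (d * 1) by rewrite ler_wpM2l// ler_wpM2l// ltW.
by have := mulr_ge0 K0 r0; nra.
Qed.

End Contact.

Lemma eucl_norm_le_sum (R : realType) m (v : 'rV[R]_m) :
  eucl_norm v <= \sum_i `|v 0 i|.
Proof.
have S0 : 0 <= \sum_i `|v 0 i| by apply: sumr_ge0.
rewrite /eucl_norm -[leRHS]ger0_norm// -sqrtr_sqr ler_wsqrtr//.
rewrite expr2 mulr_suml; apply: ler_sum => i _.
rewrite -real_normK ?num_real// expr2 ler_wpM2l//.
by rewrite (bigD1 i)//= lerDl sumr_ge0.
Qed.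

(** * Proof of the theorem *)

Section Slice.
Variables (R : realType) (n k : nat) (f : 'rV[R]_k -> heis R n).
Variables (Omega : set 'rV[R]_k) (x0 : 'rV[R]_k) (rad L : R).
Hypotheses (n_lt_k : (n < k)%N) (rad0 : 0 < rad) (rad1 : rad <= 1) (L0 : 0 <= L).
Let box (y : 'rV[R]_k) := forall i, `|y 0 i - x0 0 i| <= rad.
Hypothesis box_Omega : forall y, box y -> Omega y.
Hypothesis f_lip : forall y z, box y -> box z ->
  eucl_dist (f y) (f z) <= L * eucl_dist y z.
Hypothesis f_inj : {in Omega &, injective f}.
Hypothesis f_holder : holder_plus (@eucl_dist R k) (@dcc R n) 2^-1 Omega f.
Local Notation X := 'rV[R]_n.+1.

(* [slice] retracts R^(n+1) onto a cube, which is embedded in Omega. *)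
Definition slice (x : X) : 'rV[R]_k := \row_i
  (x0 0 i + rad * (if (i < n.+1)%N then clamp (x 0 (inord i)) else 0)).

Definition fs (x : X) : heis R n := f (slice x).

Lemma slice_box x : box (slice x).
Proof.
move=> i; rewrite mxE addrAC subrr add0r normrM (ger0_norm (ltW rad0)).
rewrite ler_piMr ?(ltW rad0)//.
case: ifP => _; last by rewrite normr0.
by have /andP[c0 c1] := clamp_itv (x 0 (inord i)); rewrite ger0_norm.
Qed.

Lemma slice_dist x y : eucl_dist (slice x) (slice y) <=
  rad * \sum_(i < n.+1) `|clamp (x 0 i) - clamp (y 0 i)|.
Proof.
apply: le_trans (eucl_norm_le_sum _) _.
pose F i := `|clamp (x 0 (inord i)) - clamp (y 0 (inord i))|.
have -> : \sum_(i < n.+1) `|clamp (x 0 i) - clamp (y 0 i)| = \sum_(i < n.+1) F i.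
  by apply: eq_bigr => i _; rewrite /F inord_val.
rewrite (big_ord_widen k F n_lt_k) [X in rad * X]big_mkcond /= mulr_sumr.
apply: ler_sum => i _; rewrite !mxE opprD addrACA subrr add0r -mulrBr normrM.
rewrite (ger0_norm (ltW rad0)) ler_wpM2l ?(ltW rad0)//.
by case: ifP => _ //; rewrite subrr normr0.
Qed.

Lemma slice_shv h i x : 0 <= h ->
  eucl_dist (slice x) (slice (shv h i x)) <= rad * h.
Proof.
move=> h0; apply: le_trans (slice_dist _ _) _; rewrite ler_wpM2l ?(ltW rad0)//.
rewrite (bigD1 i)//= big1 ?addr0; last first.
  by move=> j ji; rewrite shvE (negbTE ji) mulr0 addr0 subrr normr0.
apply: le_trans (clamp_lip _ _) _.
by rewrite shvE eqxx mulr1 opprD addrA subrr sub0r normrN ger0_norm.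
Qed.

Lemma fs_lip x y m : `|fs x 0 m - fs y 0 m| <=
  L * (rad * \sum_(i < n.+1) `|clamp (x 0 i) - clamp (y 0 i)|).
Proof.
have := ler_eucl_norm (fs x - fs y) m; rewrite !mxE => /le_trans; apply.
apply: le_trans (f_lip (slice_box x) (slice_box y)) _.
by rewrite ler_wpM2l// slice_dist.
Qed.

Lemma lipb_fs m : lipb (fun x => fs x 0 m).
Proof.
have C0 : 0 <= L * (rad * n.+1%:R) by rewrite !mulr_ge0 ?(ltW rad0).
have Lr0 : 0 <= L * rad by rewrite mulr_ge0 ?(ltW rad0).
exists (`|fs 0 0 m| + L * (rad * n.+1%:R) + L * rad) => [x|h i x h0].
  apply: (@le_trans _ _ (`|fs 0 0 m| + L * (rad * n.+1%:R))); last by rewrite lerDl.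
  rewrite -[fs x 0 m](subrK (fs 0 0 m)) addrC (le_trans (ler_normD _ _))// lerD2l.
  apply: le_trans (fs_lip _ _ _) _; rewrite !ler_wpM2l ?(ltW rad0)//.
  apply: (@le_trans _ _ (\sum_(i < n.+1) 1)); last by rewrite sumr_const card_ord.
  apply: ler_sum => i _.
  have /andP[a0 a1] := clamp_itv (x 0 i).
  have /andP[b0 b1] := clamp_itv ((0 : X) 0 i).
  by rewrite ler_norml; apply/andP; split; lra.
rewrite distrC.
have := ler_eucl_norm (fs x - fs (shv h i x)) m; rewrite !mxE => /le_trans; apply.
apply: le_trans (f_lip (slice_box x) (slice_box _)) _.
apply: (@le_trans _ _ (L * rad * h)).
  by rewrite -mulrA ler_wpM2l// slice_shv.
by rewrite ler_wpM2r// lerDr addr_ge0.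
Qed.

Lemma contact_edgeo : edgeo (fun h i x => contact_defect (fs x) (fs (shv h i x))).
Proof.
case: f_holder => beta [cb mb b0 bz hb] e e0.
pose K : R := n%:R * 4; have K0 : 0 <= K by rewrite mulr_ge0.
have K1 : 0 < K + 1 by rewrite ltr_wpDl.
(* The target bound for [beta]: the defect is at most K h s^2, which s <= 1 reduces to K h s, and K
   s <= e. *)
pose s := Num.min 1 (e / (K + 1)).
have s0 : 0 < s by rewrite lt_min ltr01 divr_gt0.
have s1 : s <= 1 by rewrite ge_min lexx.
have sK : s * (K + 1) <= e by rewrite -ler_pdivlMr// ge_min lexx orbT.
have /subspace_continuousP/(_ 0) := cb.
rewrite /= in_itv/= lexx => /(_ isT) /cvgrPdist_lt /(_ _ s0).
rewrite near_withinE => -[d /= d0 db].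
exists d => // h i x h0 hd.
have hn : beta h <= s.
  have : `|h| < d -> h \in `[0, +oo[ -> `|beta 0 - beta h| < s.
    by move=> hd'; apply: db; rewrite /= sub0r normrN.
  rewrite bz sub0r normrN gtr0_norm// in_itv/= andbT.
  by move=> /(_ hd (ltW h0)) /ltW; apply: le_trans; exact: ler_norm.
set y := shv h i x; pose dl := eucl_dist (slice x) (slice y).
have dl0 : 0 <= dl by exact: sqrtr_ge0.
have dlh : dl <= h.
  apply: le_trans (slice_shv _ _ (ltW h0)) _.
  by rewrite ler_piMl// ltW.
have bdl : beta dl <= s.
  apply: le_trans hn; apply: mb => //; rewrite in_itv/= andbT//.
  exact: ltW.
have bdl0 : 0 <= beta dl by exact: b0.
have r0 : 0 <= dl `^ 2^-1 * beta dl by rewrite mulr_ge0// powR_ge0.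
have := hb (slice x) (slice y) (box_Omega (slice_box _)) (box_Omega (slice_box _)).
move=> /(dcc_contact_le r0) /le_trans; apply.
rewrite powR12_sqrt// -/K.
have -> : K * (Num.sqrt dl * beta dl) * (Num.sqrt dl * beta dl) =
    K * (Num.sqrt dl ^+ 2 * (beta dl * beta dl)) by ring.
rewrite sqr_sqrtr//.
apply: (@le_trans _ _ (K * (h * (s * 1)))).
  rewrite ler_wpM2l// ler_pM ?mulr_ge0//; rewrite ler_pM//.
  exact: le_trans s1.
have Ks : K * s <= e by move: sK; rewrite mulrDr mulr1 mulrC; lra.
have -> : K * (h * (s * 1)) = K * s * h by ring.
by rewrite ler_wpM2r ?(ltW h0).
Qed.

Definition xc (j : 'I_n) (x : X) : R := fs x 0 (xidx j).
Definition yc (j : 'I_n) (x : X) : R := fs x 0 (yidx j).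
Definition tc (x : X) : R := fs x 0 (tidx n).
Definition fl (a : 'I_n * bool) : X -> R := if a.2 then yc a.1 else xc a.1.

Lemma lipb_fl a : lipb (fl a).
Proof. by rewrite /fl; case: a.2; exact: lipb_fs. Qed.

(* The function t / 4 - (sum_j x_j y_j) / 2 turns the contact form into
   sum_j x_j dy_j plus an exact form. *)
Lemma words_null psi (w : seq ('I_n * bool)) : lipb psi -> cpt psi ->
  (n < size w)%N -> nullseq (wint psi (map fl w)).
Proof.
apply: (@contact_words_null R n n.+1 xc yc
  (fun x => 4^-1 * (tc x - 2 * \sum_j xc j x * yc j x))).
- by move=> j; exact: lipb_fs.
- by move=> j; exact: lipb_fs.
(* On a grid the increment of x y contains the product of the increments of x and y, a quadratic
   term that enters with weight -1/2. *)
have xyo : edgeo (fun h i x => \sum_j (xc j (shv h i x) - xc j x) *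
    (yc j (shv h i x) - yc j x)).
  by apply: edgeo_sum => j; apply: lipb_dif2; exact: lipb_fs.
apply: edgeo_ext (edgeoD (edgeoM (g := fun=> 4^-1) (M := 4^-1) _ contact_edgeo)
  (edgeoM (g := fun=> - 2^-1) (M := 2^-1) _ xyo)); last 2 first.
- by move=> _; rewrite ger0_norm// invr_ge0.
- by move=> _; rewrite normrN ger0_norm// invr_ge0.
move=> h i x; rewrite /contact_defect -/(tc _) -/(tc _).
set y := shv h i x.
have E : \sum_j xc j y * yc j y = \sum_j xc j x * yc j x +
  (2 * \sum_j xc j x * (yc j y - yc j x) +
   \sum_(j < n) 2^-1 * (2 * fs x 0 (yidx j) * (fs y 0 (xidx j) - fs x 0 (xidx j)) -
      2 * fs x 0 (xidx j) * (fs y 0 (yidx j) - fs x 0 (yidx j))) +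
   \sum_j (xc j y - xc j x) * (yc j y - yc j x)).
  rewrite mulr_sumr -!big_split /=; apply: eq_bigr => j _.
  by rewrite /xc /yc; field.
by rewrite E -mulr_sumr; field.
Qed.

Lemma smooth_coord m : fsmooth fl (fun x => fs x 0 m).
Proof.
have [->|mt] := eqVneq m (tidx n).
  split; first exact: lipb_fs.
  exists (fun a => if a.2 then (fun x => - 2 * xc a.1 x) else (fun x => 2 * yc a.1 x)).
    by move=> [j []]; apply: lipbZ; exact: lipb_fs.
  apply: edgeo_ext contact_edgeo => h i x; rewrite /contact_defect; congr (_ - _).
  rewrite (eq_bigr (fun a : 'I_n * bool => (fun j b => (if b then - 2 * xc j x else
    2 * yc j x) * (fl (j, b) (shv h i x) - fl (j, b) x)) a.1 a.2)); last first.
    by case=> j [].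
  rewrite -(pair_bigA _ (fun j b => (if b then - 2 * xc j x else
    2 * yc j x) * (fl (j, b) (shv h i x) - fl (j, b) x))) /=.
  apply: eq_bigr => j _; rewrite big_bool /fl /xc /yc /=; ring.
have mn : (m < n.*2)%N.
  have := ltn_ord m; rewrite ltnS leq_eqVlt => /predU1P[mE|//].
  by case/eqP: mt; exact: val_inj.
have hj : (m./2 < n)%N by rewrite -(odd_double_half m) in mn; lia.
have := smooth_fl lipb_fl (Ordinal hj, odd m); apply: smooth_ext => x.
rewrite /fl /xc /yc /=.
by case: ifP => om; congr (fs x 0 _); apply: ord_inj;
  rewrite ?val_xidx ?val_yidx /= -[RHS](odd_double_half m) om.
Qed.

(** * Separation of the images of opposite slabs *)

Definition fdist2 (x y : X) : R := \sum_m (fs x 0 m - fs y 0 m) ^+ 2.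

Lemma fs_continuous m : continuous (fun x => fs x 0 m).
Proof.
move=> /= x A /= /(nbhs_ballP (fs x 0 m)) [e /= e0 eA].
pose C := L * (rad * n.+1%:R); have C0 : 0 <= C by rewrite !mulr_ge0 ?(ltW rad0).
have C1 : 0 < C + 1 by rewrite ltr_wpDl.
have d0 : 0 < e / (C + 1) by exact: divr_gt0.
apply/nbhs_ballP; exists (e / (C + 1)) => //= y [_ xy].
apply: eA; rewrite /ball /=.
apply: le_lt_trans (fs_lip _ _ _) _.
apply: (@le_lt_trans _ _ (C * (e / (C + 1)))).
  rewrite /C -!mulrA !ler_wpM2l ?(ltW rad0)//.
  apply: (@le_trans _ _ (\sum_(i < n.+1) (e / (C + 1)))).
    apply: ler_sum => i _; apply: le_trans (clamp_lip _ _) _.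
    exact/ltW/xy.
  by rewrite sumr_const card_ord -[leLHS]mulr_natl.
by rewrite mulrCA gtr_pMr// ltr_pdivrMr// mul1r ltrDl.
Qed.

Lemma slice_inj x y : slice x = slice y -> forall i, clamp (x 0 i) = clamp (y 0 i).
Proof.
move=> /rowP xy i; have := xy (widen_ord n_lt_k i); rewrite !mxE /= ltn_ord.
by move=> /addrI /(mulfI (negbT (gt_eqF rad0))); rewrite inord_val.
Qed.

Lemma clamp_id (t : R) : 0 <= t <= 1 -> clamp t = t.
Proof.
case/andP=> t0 t1; rewrite /clamp /Num.min /Num.max; case: (ltP 0 t) => tt.
  by case: (ltP 1 t) => ?; lra.
by rewrite ltr10; lra.
Qed.

(** Clamping makes the slabs compact, and injectivity of [f] makes the minimum of [fdist2] positive.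
    The upper slab starts at 1/2, not 2/3, to contain the grid points close to points with
    coordinate at least 2/3. *)
Lemma fs_separated (i : 'I_n.+1) : exists2 rho : R, 0 < rho &
  forall x y : X, x 0 i <= 3^-1 -> 2^-1 <= y 0 i -> rho <= fdist2 x y.
Proof.
pose clv (x : X) : X := \row_j clamp (x 0 j).
have clampK t : clamp (clamp t) = clamp t :> R by rewrite clamp_id// clamp_itv.
have fs_clv (x : X) : fs (clv x) = fs x.
  congr f; apply/rowP => j; rewrite !mxE; case: ifP => // _.
  by rewrite clampK.
pose A0 (j : 'I_n.+1) : set R := if j == i then `[0, 3^-1]%classic else `[0, 1]%classic.
pose A1 (j : 'I_n.+1) : set R := if j == i then `[2^-1, 1]%classic else `[0, 1]%classic.
have cA0 : compact [set v : X | forall j, A0 j (v ord0 j)].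
  by apply: rV_compact => j; rewrite /A0; case: ifP => _; exact: segment_compact.
have cA1 : compact [set v : X | forall j, A1 j (v ord0 j)].
  by apply: rV_compact => j; rewrite /A1; case: ifP => _; exact: segment_compact.
have cfst m : continuous (fun z : X * X => fs z.1 0 m).
  by move=> z; apply: (@continuous_comp _ _ _ fst (fun x => fs x 0 m));
    [exact: cvg_fst|exact: fs_continuous].
have csnd m : continuous (fun z : X * X => fs z.2 0 m).
  by move=> z; apply: (@continuous_comp _ _ _ snd (fun x => fs x 0 m));
    [exact: cvg_snd|exact: fs_continuous].
have cfd : continuous (fun z : X * X => fdist2 z.1 z.2).
  apply: continuous_big; first exact: add_continuous.
  move=> m _.
  have cd : continuous (fun z : X * X => fs z.1 0 m - fs z.2 0 m).
    by move=> z; exact: (continuousB (@cfst m z) (@csnd m z)).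
  under eq_fun do rewrite expr2.
  by move=> z; exact: (continuousM (cd z) (cd z)).
have clv0 (x : X) : x 0 i <= 3^-1 -> forall j, A0 j (clv x ord0 j).
  move=> xi j; rewrite /A0 mxE; have /andP[c0 c1] := clamp_itv (x 0 j).
  case: eqP => [->|_]; rewrite /= in_itv/= ?c0 ?c1//=.
  have [x0i|x0i] := leP 0 (x 0 i); last by rewrite clamp_le0 ?lexx ?invr_ge0// ltW.
  by rewrite clamp_id ?x0i ?xi//; apply/andP; split => //; lra.
have clv1 (x : X) : 2^-1 <= x 0 i -> forall j, A1 j (clv x ord0 j).
  move=> xi j; rewrite /A1 mxE; have /andP[c0 c1] := clamp_itv (x 0 j).
  case: eqP => [->|_]; rewrite /= in_itv/= ?c0 ?c1//=.
  have [xi1|xi1] := leP (x 0 i) 1; last by rewrite clamp_ge1 ?(ltW xi1)//; lra.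
  by rewrite clamp_id ?xi ?xi1//; apply/andP; split => //; lra.
have [|[u v]] := compact_EVT_min _ (compact_setX cA0 cA1) (continuous_subspaceT cfd).
  exists (clv 0, clv (const_mx 1)); split=> /=.
    by apply: clv0; rewrite mxE invr_ge0.
  by apply: clv1; rewrite mxE; lra.
rewrite inE => -[/= uA vA] fmin.
exists (fdist2 u v); last first.
  move=> x y xi yi.
  have -> : fdist2 x y = fdist2 (clv x) (clv y) by rewrite /fdist2 !fs_clv.
  by apply: (fmin (clv x, clv y)); rewrite inE; split => /=; [exact: clv0|exact: clv1].
have fd0 : 0 <= fdist2 u v by apply: sumr_ge0 => m _; exact: sqr_ge0.
rewrite lt_neqAle fd0 andbT eq_sym; apply/negP => /eqP fuv.
have fuvE : fs u = fs v.
  apply/rowP => m; apply/eqP; rewrite -subr_eq0 -sqrf_eq0.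
  have := psumr_eq0P (fun m _ => sqr_ge0 (fs u 0 m - fs v 0 m)) fuv.
  by move=> /(_ m isT) ->.
have : slice u = slice v.
  by apply: f_inj; rewrite ?inE//; exact/box_Omega/slice_box.
move=> /slice_inj /(_ i).
have := uA i; have := vA i; rewrite /A0 /A1 eqxx /= !in_itv/=.
move=> /andP[v1 v2] /andP[u1 u2]; rewrite !clamp_id; try (apply/andP; split); lra.
Qed.

Lemma smooth_plateau (i : 'I_n.+1) : exists2 g, fsmooth fl g & plateau i g.
Proof.
have [rho rho0 sep] := fs_separated i.
pose C := \sum_(m < n.*2.+1) (L * (rad * n.+1%:R)) ^+ 2.
have C0 : 0 <= C by apply: sumr_ge0 => m _; exact: sqr_ge0.
(* Mesh at most 1/6 = 2/3 - 1/2 keeps those grid points in the upper slab; the second bound brings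
   [fdist2] to a neighbouring grid point below rho / 2. *)
have [N [N6 NC]] : exists N, 6%:R <= N.+1%:R :> R /\ 2 * C / rho <= N.+1%:R.
  exists (6 + Num.bound (2 * C / rho))%N; split; first by rewrite ler_nat; lia.
  have c0 : 0 <= 2 * C / rho by rewrite !mulr_ge0// invr_ge0 ltW.
  apply: le_trans (ltW (archi_boundP c0)) _; rewrite ler_nat; lia.
have Np : 0 < N.+1%:R :> R by rewrite ltr0n.
pose mid (z : {ffun 'I_n.+1 -> 'I_N.+1}) := 2^-1 <= @pt R n.+1 N z 0 i.
(* Finitely many bumps around the images of grid points of the upper slab: [H] is 0 on the lower
   slab and at least rho^2 / 4 = 1 / c where the coordinate is at least 2/3. *)
pose H (x : X) := \sum_(z | mid z) pos_part (rho - fdist2 x (@pt R n.+1 N z)) ^+ 2.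
pose c := 4 / rho ^+ 2.
(* With s = c H, the outer function is 0 at s = 0 and 1 for s >= 1, and is composed of operations
   preserving [fsmooth]. *)
pose g (x : X) := pos_part (1 - pos_part (1 - c * H x) ^+ 2) ^+ 2.
have sH : fsmooth fl H.
  apply: smooth_sum => z; apply: smooth_pos_part.
  apply: smoothB; first exact: smooth_cst.
  apply: smooth_sum => m.
  have sm : fsmooth fl (fun x => fs x 0 m - fs (@pt R n.+1 N z) 0 m).
    by apply: smoothB; [exact: smooth_coord|exact: smooth_cst].
  by apply: smooth_ext (smoothM sm sm) => x.
have s1 u : fsmooth fl u -> fsmooth fl (fun x => pos_part (1 - u x) ^+ 2).
  by move=> su; apply: smooth_pos_part; apply: smoothB => //; exact: smooth_cst.
exists g.
  apply: smooth_pos_part; apply: smoothB; first exact: smooth_cst.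
  by apply: s1; apply: smoothZ.
split=> x xi.
  rewrite /g (_ : H x = 0); last first.
    rewrite /H big1// => z mz; rewrite /pos_part max_l ?expr0n//.
    by rewrite subr_le0; exact: sep.
  rewrite mulr0 subr0 (_ : pos_part 1 = 1) ?expr1n ?subrr; last first.
    by rewrite /pos_part max_r.
  by rewrite /pos_part maxxx expr0n.
rewrite /g (_ : pos_part (1 - c * H x) = 0) ?expr0n/= ?subr0; last first.
  rewrite /pos_part max_l// subr_le0.
  (* Rounding down to the grid; [minn N] treats coordinate 1, whose index would be N + 1, and the
     error stays within one mesh. *)
  pose z : {ffun 'I_n.+1 -> 'I_N.+1} :=
    [ffun j => inord (minn N (Num.truncn (N.+1%:R * clamp (x 0 j))))].
  have zx j : `|clamp (x 0 j) - pt R z 0 j| <= N.+1%:R^-1 /\ 0 <= pt R z 0 j <= 1.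
    have /andP[t0 t1] := clamp_itv (x 0 j).
    rewrite mxE ffunE inordK ?ltnS ?geq_minl//.
    have a0 : 0 <= N.+1%:R * clamp (x 0 j) by rewrite mulr_ge0// ltW.
    have /andP[] := truncn_itv a0; set tr := Num.truncn _ => tr1 tr2.
    have trN : (tr <= N.+1)%N.
      rewrite -(ler_nat R) (le_trans tr1)// -[leRHS]mulr1 ler_wpM2l// ltW//.
    have m1 : (minn N tr)%:R <= tr%:R :> R by rewrite ler_nat geq_minr.
    have m2 : N.+1%:R * clamp (x 0 j) <= (minn N tr)%:R + 1 :> R.
      rewrite natr1; have [trN'|trN'] := leqP N tr.
        by rewrite -[leRHS]mulr1 ler_wpM2l// ltW.
      exact: ltW.
    have m3 : (minn N tr)%:R <= N.+1%:R :> R.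
      by rewrite ler_nat (leq_trans (geq_minl _ _)).
    split; last by rewrite divr_ge0//= ler_pdivrMr// mul1r.
    have -> : clamp (x 0 j) - (minn N tr)%:R / N.+1%:R =
      (N.+1%:R * clamp (x 0 j) - (minn N tr)%:R) / N.+1%:R.
      by field; rewrite gt_eqF.
    have ci0 : 0 <= N.+1%:R^-1 :> R by rewrite invr_ge0 ltW.
    rewrite normrM (@ger0_norm _ N.+1%:R^-1)//; apply: ler_piMl => //.
    by rewrite ler_norml; apply/andP; split; lra.
  have clz j : clamp (pt R z 0 j) = pt R z 0 j by rewrite clamp_id//; case: (zx j).
  have mz : mid z.
    have N61 : N.+1%:R^-1 <= 6^-1 :> R by rewrite lef_pV2 ?posrE.
    have x23 : 2 / 3 <= clamp (x 0 i).
      have [x1|x1] := leP (x 0 i) 1; first by rewrite clamp_id//; apply/andP; split; lra.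
      by rewrite clamp_ge1 ?(ltW x1)//; lra.
    have [+ _] := zx i; rewrite /mid ler_norml; move: N61 x23.
    move: (N.+1%:R^-1) (clamp _) (pt R z 0 i) => a b d a6 b23 /andP[? ?].
    by lra.
  have dz : fdist2 x (pt R z) <= rho / 2.
    apply: (@le_trans _ _ (C * N.+1%:R^-1)).
      rewrite /C mulr_suml; apply: ler_sum => m _.
      rewrite -real_normK ?num_real//.
      apply: (@le_trans _ _ ((L * (rad * n.+1%:R) * N.+1%:R^-1) ^+ 2)).
        rewrite lerXn2r ?nnegrE ?mulr_ge0 ?invr_ge0 ?(ltW rad0) ?(ltW Np)//.
        apply: le_trans (fs_lip _ _ _) _; rewrite -!mulrA !ler_wpM2l ?(ltW rad0)//.
        apply: (@le_trans _ _ (\sum_(j < n.+1) N.+1%:R^-1)).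
          by apply: ler_sum => j _; rewrite clz; case: (zx j).
        by rewrite sumr_const card_ord -[leLHS]mulr_natl.
      rewrite exprMn ler_wpM2l ?sqr_ge0// expr2.
      by apply: ler_piMl; [rewrite invr_ge0 ltW|rewrite invf_le1// ler1n].
    rewrite ler_pdivrMr//; move: NC; rewrite ler_pdivrMr// => NC; lra.
  have Hx : rho ^+ 2 / 4 <= H x.
    rewrite /H (bigD1 z)//=.
    apply: (@le_trans _ _ (pos_part (rho - fdist2 x (pt R z)) ^+ 2)); last first.
      by rewrite lerDl sumr_ge0// => z' _; exact: sqr_ge0.
    have -> : rho ^+ 2 / 4 = (rho / 2) ^+ 2 by field.
    rewrite lerXn2r ?nnegrE ?divr_ge0 ?(ltW rho0)//.
      by rewrite /pos_part le_max lexx.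
    by rewrite /pos_part le_max; apply/orP; right; lra.
  apply: (@le_trans _ _ (c * (rho ^+ 2 / 4))).
    by rewrite /c (_ : 4 / rho ^+ 2 * (rho ^+ 2 / 4) = 1)//; field; rewrite gt_eqF.
  by rewrite ler_wpM2l// /c divr_ge0// sqr_ge0.
by rewrite /pos_part max_r ?expr1n.
Qed.

Lemma slice_contradiction : False.
Proof.
have [G Gs] : exists G : 'I_n.+1 -> X -> R,
    forall i, fsmooth fl (G i) /\ plateau i (G i).
  have /choice[G hG] : forall i : 'I_n.+1, exists g, fsmooth fl g /\ plateau i g.
    by move=> i; have [g gs gp] := smooth_plateau i; exists g.
  by exists G.
have nul : nullseq (wint (@cutoff R n.+1) (map G (enum 'I_n.+1))).
  apply: (@wint_fsmooth R n.+1 _ fl n.+1 lipb_fl).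
  - by move=> psi w psil psi0 wn; apply: words_null => //; rewrite wn.
  - exact: lipb_cutoff.
  - exact: cpt_cutoff.
  - by rewrite size_map size_enum_ord.
  - by elim: (enum _) => //= j l IH; split => //; case: (Gs j).
have half0 : 0 < 2^-1 :> R by rewrite invr_gt0.
have [N0 N0h] := nul _ half0.
(* This threshold gives (n + 3) / (N + 1) <= 1/6, the condition of [wint_plateau] in dimension n +
   1. *)
have n3 : 0 < (6 * n.+3%:R)^-1 :> R by rewrite invr_gt0 mulr_gt0.
have [N1 N1h] := @nullseq_inv R _ n3.
have := N0h (maxn N0 N1) (leq_maxl _ _).
rewrite wint_plateau ?normr1.
- by rewrite invf_ge1// leNgt ltr1n.
- by move=> i; case: (Gs i).
have := N1h (maxn N0 N1) (leq_maxr _ _).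
rewrite gtr0_norm ?invr_gt0 ?ltr0n// => h.
rewrite mulrC -ler_pdivlMr// mulrC -invfM mulrC.
by apply: le_trans h _; rewrite mulrC.
Qed.

End Slice.

Theorem theorem1p11 (R : realType) (n k : nat) (n_gt0 : (0 < n)%N)
    (n_lt_k : (n < k)%N) (Omega : set 'rV[R]_k) (Omega_open : open Omega)
    (Omega_neq0 : Omega !=set0) :
  ~ exists f : 'rV[R]_k -> heis R n,
      [/\ {in Omega &, injective f},
          holder_plus (@eucl_dist R k) (@dcc R n) 2^-1 Omega f
        & locally_lipschitz Omega f].
Proof.
move=> [f [f_inj f_holder f_lip]].
case: Omega_neq0 => x0 Ox0; have [U x0U [L UL]] := f_lip x0 Ox0.
have : nbhs x0 (Omega `&` U) by apply: filterI => //; exact: open_nbhs_nbhs.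
move=> /nbhs_ballP [e /= e0 eOU].
(* The library ball is an open sup-norm cube, so a closed box of radius below [e] fits in it; the
   cap 1 ensures that [slice] does not lengthen edges. *)
pose rad := Num.min 1 (e / 2).
have rad0 : 0 < rad by rewrite lt_min ltr01 divr_gt0.
have rad_e : rad < e.
  by rewrite gt_min ltr_pdivrMr// ltr_pMr// ltr1n orbT.
have boxOU (y : 'rV[R]_k) : (forall i, `|y 0 i - x0 0 i| <= rad) -> (Omega `&` U) y.
  move=> yi; apply: eOU; split=> // i j; rewrite (ord1 i) /ball /= distrC.
  exact: le_lt_trans (yi j) rad_e.
apply: (@slice_contradiction R n k f Omega x0 rad `|L|) => //.
- by rewrite ge_min lexx.
- by move=> y /boxOU[].
- move=> y z /boxOU yOU /boxOU zOU; apply: le_trans (UL y z yOU zOU) _.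
  by rewrite ler_wpM2r ?sqrtr_ge0// ler_norm.
Qed.
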